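(* Let $\omega>0$, let $p,q,b:\mathbb{R}\to\mathbb{R}$ and $c,e:\mathbb{R}\to(0,+\infty)$ be continuous $\omega$-periodic functions, let $\rho_1,\rho_2>0$ be constants with $\rho_1>\rho_2$, and put $\alpha=\frac{1}{\rho_1+1}$. Assume that the Green's function $G$ of the $\omega$-periodic problem for $u''+p(t)u'+\frac{q(t)}{\alpha}u=h(t)$ satisfies $G(t,s)>0$ for all $(t,s)\in[0,\omega]\times[0,\omega]$, and let $G^*,G_*,\sigma,\delta$ be the associated constants (see context). Furthermore, suppose there exist $R>r>0$ such that $$\frac{1}{\sigma}\left(-\frac{b_*}{e_*}\right)^{\frac{1}{1-\alpha}}\leq r\leq\left(\frac{G_*c_*\omega\sigma^{1-\alpha-\alpha\rho_2}}{\alpha}\right)^{\frac{1}{\alpha+\alpha\rho_2}}$$ and $$\frac{(1-\alpha)(G^*+\delta G_* )\delta^2\omega}{\sigma}<1.$$ Then there is at least one positive $\omega$-periodic solution $y$ of $$y''(t)+p(t)y'(t)+\frac{q(t)}{\alpha}y(t)=\frac{c(t)}{\alpha}y^{1-\alpha-\alpha\rho_2}(t)+\frac{e(t)}{\alpha}y^{1-\alpha}(t)+(1-\alpha)\frac{|y'(t)|^2}{y(t)}+\frac{b(t)}{\alpha}$$ satisfying $r\leq\|y\|\leq R$. Consequently, $x=y^\alpha$ is a positive $\omega$-periodic solution of $$x''(t)+p(t)x'(t)+q(t)x(t)=\frac{b(t)}{x^{\rho_1}(t)}+\frac{c(t)}{x^{\rho_2}(t)}+e(t).$$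
   Context: For a continuous $\omega$-periodic function $\phi$, write $\phi^*=\max_{0\le t\le\omega}\phi(t)$, $\phi_*=\min_{0\le t\le\omega}\phi(t)$ and $\|\phi\|_\infty=\max_{t\in[0,\omega]}|\phi(t)|$. For a $C^1$ $\omega$-periodic function, $\|\phi\|=\|\phi\|_\infty+\|\phi'\|_\infty$. Green's function: for the periodic problem $u''(t)+p(t)u'(t)+\frac{q(t)}{\alpha}u(t)=h(t)$, $u(0)=u(\omega)$, $u'(0)=u'(\omega)$, with $h:\mathbb{R}\to(0,+\infty)$ continuous and $\omega$-periodic, the unique $\omega$-periodic solution is $u(t)=\int_0^\omega G(t,s)h(s)\,ds$, where $G(t,s)$ is the Green's function. Constants: $G^*=\max_{0\le s,t\le\omega}G(t,s)$, $G_*=\min_{0\le s,t\le\omega}G(t,s)$, and $$\sigma=\frac{G_*}{G^*+\max_{0\le s,t\le\omega}\left|\frac{\partial G(t,s)}{\partial t}\right|},\qquad \delta=\frac{\max_{0\le s,t\le\omega}\left|\frac{\partial G(t,s)}{\partial t}\right|}{G_*}.$$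
   Formalization: R is not given in advance with only R>r but is asserted to exist (sufficiently large): for an arbitrary R>r the bound ‖y‖≤R fails, e.g. for p=b=0, constant c,e>0, small constant q>0, small r and R=2r. If b_*>0 the lower bound on r is just r>0. *)

(* Defs.v *)
From HB Require Import structures.
From mathcomp Require Import all_boot all_order all_algebra.
From mathcomp Require Import all_classical all_reals all_analysis.

Set Implicit Arguments.
Unset Strict Implicit.
Unset Printing Implicit Defensive.

Import Order.TTheory GRing.Theory Num.Theory.
Import numFieldNormedType.Exports.

Local Open Scope ring_scope.
Local Open Scope classical_set_scope.

Section Defs.
Context {K : realType}.
Implicit Types (omega t s : K) (phi u p q f h : K -> K) (G : K -> K -> K).

(* These are only applied to functions continuous on the (nonempty) compact
   interval, for which the sup and the inf are attained. *)
Definition per_max omega phi : K := sup (phi @` `[0, omega]).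
Definition per_min omega phi : K := inf (phi @` `[0, omega]).
Definition sup_norm omega phi : K := per_max omega (fun t => `|phi t|).
Definition C1_norm omega phi : K := sup_norm omega phi + sup_norm omega (derive1 phi).

(* u is a classical omega-periodic solution of u'' + p u' + q u = f.
   In MathComp-Analysis [derive1 phi t] is a junk value where phi has no derivative,
   hence the explicit derivability clauses. *)
Definition periodic_solution omega p q f u : Prop :=
  [/\ periodic u omega,
      (forall t, derivable u t 1),
      (forall t, derivable (derive1 u) t 1) &
      (forall t, derive1 (derive1 u) t + p t * derive1 u t + q t * u t = f t)].

(* G is the Green's function of the omega-periodic problem for u'' + p u' + q u:
   integration against G yields the unique omega-periodic solution.  Together
   with continuity on the closed square this determines G on that square.  The
   regularity clause is the usual one for second-order Green's functions: dG/dt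
   jumps across the diagonal s = t, but on each of the two open triangles it
   extends continuously to the closed triangle. *)
Definition is_periodic_green omega p q G : Prop :=
  [/\ {within `[0, omega] `*` `[0, omega],
        continuous (fun z : K * K => G z.1 z.2)},
      (exists D1 D2 : K * K -> K,
        [/\ {within [set z : K * K | 0 <= z.1 /\ z.1 <= z.2 /\ z.2 <= omega],
              continuous D1},
            {within [set z : K * K | 0 <= z.2 /\ z.2 <= z.1 /\ z.1 <= omega],
              continuous D2},
            (forall t s, 0 < t -> t < s -> s <= omega ->
              is_derive t 1 (fun t' => G t' s) (D1 (t, s))) &
            (forall t s, 0 <= s -> s < t -> t < omega ->
              is_derive t 1 (fun t' => G t' s) (D2 (t, s)))]) &
      (forall h, continuous h -> periodic h omega -> (forall t, 0 < h t) ->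
        exists u,
          [/\ periodic_solution omega p q h u,
              (forall v, periodic_solution omega p q h v -> v = u) &
              (forall t, 0 <= t <= omega ->
                u t = \int[lebesgue_measure]_(s in `[0, omega])
                        (G t s * h s))])].

Definition green_max omega G : K :=
  sup [set G z.1 z.2 | z in `[0, omega] `*` `[0, omega]].
Definition green_min omega G : K :=
  inf [set G z.1 z.2 | z in `[0, omega] `*` `[0, omega]].

(* The maximum of |dG/dt| over the square.  dG/dt does not exist on the
   diagonal, and at t = 0 and t = omega only one-sidedly.  By the regularity
   clause of [is_periodic_green], the supremum over the remaining points equals
   the maximum of the one-sided values over the two closed triangles. *)
Definition green_dmax omega G : K :=
  sup [set `|derive1 (fun t => G t z.2) z.1|
       | z in [set z : K * K | 0 < z.1 < omega /\ 0 <= z.2 <= omega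
                               /\ z.1 != z.2]].

Definition green_sigma omega G : K :=
  green_min omega G / (green_max omega G + green_dmax omega G).
Definition green_delta omega G : K := green_dmax omega G / green_min omega G.

End Defs.

(* Main.v *)
Require Import Defs.
From HB Require Import structures.
From mathcomp Require Import all_boot all_order all_algebra.
From mathcomp Require Import all_classical all_reals all_analysis.
From mathcomp Require Import ring lra.

Set Implicit Arguments.
Unset Strict Implicit.
Unset Printing Implicit Defensive.

Import Order.TTheory GRing.Theory Num.Theory.
Import numFieldNormedType.Exports.

Local Open Scope ring_scope.
Local Open Scope classical_set_scope.

(* If y is the periodic solution with a positive right-hand side h, then
   y = int G h gives G_* int h <= y <= G^* int h and |y'| <= delta y.  Hence one
   may clip y to [m, R0] with m = sigma r, and |y'| at delta times the clipped
   y, in the nonlinearity: the truncation is bounded, Lipschitz and positive,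
   the hypothesis on r (resp. the growth condition, for R0 large) forces every
   periodic solution y of the truncated equation to satisfy r <= y
   (resp. y <= R0), so that such a solution is not affected by the truncation.
   For a bounded Lipschitz nonlinearity no fixed point theorem in a function
   space is needed.  The homogeneous equation has no nonzero periodic solution,
   so id - Phi is invertible for the monodromy matrix Phi, and the fixed points
   of the Poincare map P are those of (id - Phi)^-1 (P - Phi), a bounded
   Lipschitz map of the plane; Brouwer's theorem in dimension two applies. *)

(** * Primitives and differential inequalities *)

(** The obstacle is the term (1-α)|y'|²/y, quadratic in y' and singular at y = 0. The bound |y'| ≤
    δy makes it at most (1-α)δ²y: linear growth, beside two powers of y with exponents in (0,1). An
    upper bound R0 therefore reproduces itself, for R0 large, as soon as G^*ω(1-α)δ² < 1, which the
    growth condition implies because δG_* ≥ 0 and σ ≤ 1. The other obstacle is the sign of b, since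
    the estimates for y need a positive right-hand side. With m = σr, the first condition on r gives
    e_* m^(1-α) + b_* ≥ 0, so the e-term compensates b wherever y ≥ m, and the c-term is left as a
    lower bound. The second condition is a rearrangement of r ≤ G_* ω (c_*/α) m^(1-α-αρ2): the
    c-term alone, evaluated at the clipping level m, already lifts the solution to r ≥ m. *)

Section Calculus.
Context {K : realType}.
Implicit Types (f g P : K -> K).

Lemma is_derive_cont f df (t : K) : is_derive t 1 f df -> {for t, continuous f}.
Proof. by move=> [fd _]; apply/differentiable_continuous/derivable1_diffP. Qed.

Lemma derive_le (f g df dg : K -> K) (a : K) :
  (forall t : K, is_derive t 1 f (df t)) -> (forall t : K, is_derive t 1 g (dg t)) ->
  (forall t, a <= t -> df t <= dg t) -> f a <= g a ->
  forall t, a <= t -> f t <= g t.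
Proof.
move=> fd gd le_d le_a t at_.
have hd (x : K) : is_derive x 1 (g - f) (dg x - df x) by apply: is_deriveB.
have hc : {within `[a, t], continuous (g - f)}.
  by apply: continuous_subspaceT => x; exact: is_derive_cont (hd x).
have [c /[!in_itv]/= /andP[ac _] E] := MVT_segment at_ (fun x _ => hd x) hc.
have : 0 <= (dg c - df c) * (t - a).
  by rewrite mulr_ge0// ?subr_ge0// le_d.
rewrite -E /= !fctE; lra.
Qed.

Lemma is_derive_reflect f (t d : K) :
  is_derive (- t) 1 f d -> is_derive t 1 (fun s => f (- s)) (- d).
Proof.
move=> fd.
have := @is_derive1_comp K f -%R t d (-1) fd (is_deriveNid t 1).
by rewrite mulrN1.
Qed.

Lemma is_derive_translate f (t d w : K) :
  is_derive (t + w) 1 f d -> is_derive t 1 (fun s => f (s + w)) d.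
Proof.
move=> fd.
have := @is_derive1_comp K f (shift w) t d 1 fd (is_derive_shift t 1 w).
by rewrite mulr1.
Qed.

(** An integral over [[a, b]] is oriented only when [a <= b], so the base point 0 would not serve
    negative [t]. [P] uses a base [A t] below both 0 and [t]; by additivity the value does not
    depend on the base. *)
Lemma primitive_exists g : continuous g ->
  exists P, P 0 = 0 /\ forall t : K, is_derive t 1 P (g t).
Proof.
move=> gc; pose mu := @lebesgue_measure K.
have gi (a b : K) : mu.-integrable `[a, b] (EFin \o g).
  apply: continuous_compact_integrable; first exact: segment_compact.
  exact: continuous_subspaceT.
pose J a b := \int[mu]_(s in `[a, b]) g s.
have JB a a' t : a <= a' -> a' <= t -> J a t - J a a' = J a' t.
  move=> aa' a't; rewrite /J.
  rewrite (@Rintegral_itvB _ g (BLeft a) (BRight t) a') ?bnd_simp//.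
  apply: Rintegral_itv_obnd_cbnd.
  by apply: integrableS (gi a' t) => //; by apply: subset_itvr; rewrite bnd_simp.
pose A t : K := Num.min 0 t - 1.
pose P t := J (A t) t - J (A t) 0.
have PE a t : a < 0 -> a < t -> P t = J a t - J a 0.
  move=> a0 at_; rewrite /P.
  have A0 : A t <= 0 by rewrite /A; case: (leP 0 t); lra.
  have At : A t <= t by rewrite /A; case: (leP 0 t); lra.
  have [aA|Aa] := leP a (A t).
  - rewrite -(JB a (A t) t)// -(JB a (A t) 0)//; ring.
  - have [Aa1 a01 at1] := And3 (ltW Aa) (ltW a0) (ltW at_).
    by rewrite -(JB (A t) a t)// -(JB (A t) a 0)//; ring.
exists P; split=> [|t]; first by rewrite /P subrr.
(* One fixed base represents [P] on a whole neighbourhood of [t], where the fundamental theorem of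
   calculus applies. *)
pose a := A t - 1.
have a0 : a < 0 by rewrite /a /A; case: (leP 0 t); lra.
have at_ : a < t by rewrite /a /A; case: (leP 0 t); lra.
have [Jd JE] : derivable (J a) t 1 /\ (J a)^`() t = g t.
  apply: (@continuous_FTC1_closed _ g a t (t + 1)) => //; first by lra.
  exact: gc.
have Jd' : is_derive t 1 (J a - cst (J a 0)) (g t).
  rewrite -[g t]subr0; apply: is_deriveB; rewrite -JE derive1E; exact: DeriveDef.
apply: (near_eq_is_derive _ Jd').
near=> x; rewrite (PE a x)//=.
near: x; exact: lt_nbhsr.
Unshelve. all: end_near. Qed.

(** Compare [P] with [C / k * expR (k * t)] and its opposite. What matters is the factor 1/k: in the
    sup norm weighted by exp(-k|t|), integration from 0 has norm at most 1/k. *)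
Lemma primitive_bound_pos P g (C k : K) : 0 < k -> 0 <= C -> P 0 = 0 ->
  (forall t : K, is_derive t 1 P (g t)) ->
  (forall t, 0 <= t -> `|g t| <= C * expR (k * t)) ->
  forall t, 0 <= t -> `|P t| <= C / k * expR (k * t).
Proof.
move=> k0 C0 P0 Pd gb.
pose E (c t : K) : K := c / k * expR (k * t).
have Ed (c t : K) : is_derive t 1 (E c) (c * expR (k * t)).
  have h1 : is_derive t 1 (k \*: (id : K -> K)) (k *: (1 : K)) by exact: is_deriveZ.
  have h2 := @is_derive1_comp K expR (k \*: (id : K -> K)) t _ _ (is_derive_expR _) h1.
  have h3 := @is_deriveZ _ _ _ _ (c / k) _ _ _ h2.
  apply: (is_derive_eq h3).
  by rewrite /GRing.scale/=; field; exact: lt0r_neq0.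
have CE0 t : 0 <= C / k * expR (k * t) by rewrite mulr_ge0 ?expR_ge0// divr_ge0// ltW.
move=> t t0; rewrite ler_norml; apply/andP; split.
- have -> : - (C / k * expR (k * t)) = E (- C) t by rewrite /E; ring.
  apply: (derive_le (Ed (- C)) Pd) t0 => [s s0|].
    by have := gb s s0; rewrite ler_norml => /andP[+ _]; rewrite mulNr.
  by rewrite P0 /E; have := CE0 0; lra.
- rewrite -/(E C t); apply: (derive_le Pd (Ed C)) t0 => [s s0|].
    by have := gb s s0; rewrite ler_norml => /andP[].
  by rewrite P0; exact: CE0.
Qed.

Lemma primitive_bound P g (C k : K) : 0 < k -> 0 <= C -> P 0 = 0 ->
  (forall t : K, is_derive t 1 P (g t)) ->
  (forall t, `|g t| <= C * expR (k * `|t|)) ->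
  forall t, `|P t| <= C / k * expR (k * `|t|).
Proof.
move=> k0 C0 P0 Pd gb t; have [t0|t0] := leP 0 t.
  rewrite (ger0_norm t0); apply: (primitive_bound_pos _ _ P0 Pd) t0 => // s s0.
  by rewrite -{2}(ger0_norm s0) gb.
rewrite (ltr0_norm t0) -{1}(opprK t).
have t0' : 0 <= - t by lra.
apply: (@primitive_bound_pos (fun s => P (- s)) (fun s => - g (- s))) t0' => //.
- by rewrite oppr0.
- by move=> s; exact: is_derive_reflect.
- by move=> s s0; rewrite normrN -{2}(ger0_norm s0) -(normrN s) gb.
Qed.

Lemma lipschitz2_comp_continuous (T : topologicalType) (F : K -> K -> K)
    (L : K) (y v : T -> K) :
  0 <= L -> (forall a b a' b', `|F a b - F a' b'| <= L * (`|a - a'| + `|b - b'|)) ->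
  continuous y -> continuous v -> continuous (fun t => F (y t) (v t)).
Proof.
move=> L0 FL yc vc t; apply/cvgrPdist_lt => e e0.
have e1 : 0 < e / (2 * (L + 1)) by rewrite divr_gt0//; lra.
near=> s; apply: (le_lt_trans (FL _ _ _ _)).
have h1 : `|y t - y s| < e / (2 * (L + 1)).
  by near: s; apply: cvgr_dist_lt => //; exact: yc.
have h2 : `|v t - v s| < e / (2 * (L + 1)).
  by near: s; apply: cvgr_dist_lt => //; exact: vc.
have : (L + 1) * (`|y t - y s| + `|v t - v s|) < e.
  rewrite -ltr_pdivlMl; last lra.
  have -> : (L + 1)^-1 * e = e / (2 * (L + 1)) + e / (2 * (L + 1)).
    by field; rewrite lt0r_neq0//; lra.
  exact: ltrD.
by apply: le_lt_trans; rewrite ler_wpM2r ?addr_ge0//; lra.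
Unshelve. all: end_near. Qed.

End Calculus.

(** * Global solutions of initial value problems *)

Section Picard.
Context {K : realType}.

Lemma le_geometric_eq0 (x D : K) : (forall n, `|x| <= D / 2 ^+ n) -> x = 0.
Proof.
move=> H; apply/eqP; rewrite -normr_le0.
have c0 : (geometric D (2^-1 : K)) @ \oo --> (0 : K).
  by apply: cvg_geometric; rewrite ger0_norm ?invr_ge0// invf_lt1// ltr1n.
rewrite -(cvg_lim _ c0)//; apply: limr_ge; first by apply: cvgP c0.
by near=> n; rewrite /= exprVn; exact: H.
Unshelve. all: end_near. Qed.

Lemma geometric_cauchy_lim (u : nat -> K) (D : K) :
  (forall n, `|u n.+1 - u n| <= D / 2 ^+ n) ->
  exists l, forall n, `|u n - l| <= 2 * D / 2 ^+ n.
Proof.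
move=> H.
have step n m : `|u (n + m)%N - u n| <= 2 * D / 2 ^+ n.
  (* Subtracting the remaining tail of the geometric series lets the induction on [m] close. *)
  have : `|u (n + m)%N - u n| <= 2 * D / 2 ^+ n - 2 * D / 2 ^+ (n + m).
    elim: m => [|m IH]; first by rewrite addn0 !subrr normr0.
    rewrite addnS; have -> : u (n + m).+1 - u n =
        (u (n + m).+1 - u (n + m)%N) + (u (n + m)%N - u n) by ring.
    apply: (le_trans (ler_normD _ _)); apply: (le_trans (lerD (H _) IH)).
    rewrite exprS; have : 2 * D / (2 * 2 ^+ (n + m)) = D / 2 ^+ (n + m).
      by field; rewrite expf_neq0.
    move=> ->; have -> : 2 * D / 2 ^+ (n + m) = D / 2 ^+ (n + m) + D / 2 ^+ (n + m) by ring.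
    by lra.
  move/le_trans; apply; rewrite lerBlDr lerDl divr_ge0// ?exprn_ge0//.
  by have := le_trans (normr_ge0 _) (H 0%N); rewrite expr0 divr1; lra.
have c0 : (geometric (2 * D) (2^-1 : K)) @ \oo --> (0 : K).
  by apply: cvg_geometric; rewrite ger0_norm ?invr_ge0// invf_lt1// ltr1n.
have uc : cvgn u.
  apply: cauchy_cvg; apply: cauchy_exP => e e0.
  have : \forall n \near \oo, `|0 - geometric (2 * D) (2^-1) n| < e.
    by apply: cvgr_dist_lt.
  case=> N _ HN; exists (u N); exists N => // m /= Nm.
  rewrite -ball_normE /= distrC -(subnKC Nm).
  apply: (le_lt_trans (step _ _)); have := HN N (leqnn N).
  by rewrite /= exprVn sub0r normrN; apply: le_lt_trans; exact: ler_norm.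
exists (limn u) => n; rewrite distrC.
have un : (fun m => u m - u n) @ \oo --> limn u - u n.
  by apply: cvgB => //; exact: cvg_cst.
rewrite -(cvg_lim _ un)// -lim_norm; last exact: cvgP un.
apply: limr_le; first by apply: is_cvg_norm; exact: cvgP un.
by exists n => // m /= nm; rewrite -(subnKC nm).
Qed.

(** The convergence is only locally uniform: near [t] the continuous factor [M] stays below
    [|M t| + 1], and the usual three-epsilon argument goes through. *)
Lemma continuous_geometric_lim (u : nat -> K -> K) (v M : K -> K) :
  (forall n, continuous (u n)) -> continuous M ->
  (forall n t, `|u n t - v t| <= M t / 2 ^+ n) -> continuous v.
Proof.
move=> uc Mc H t; apply/cvgrPdist_lt => e e0.
have [n Hn] : exists n, (`|M t| + 1) / 2 ^+ n < e / 3.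
  have c0 : (geometric (`|M t| + 1) (2^-1 : K)) @ \oo --> (0 : K).
    by apply: cvg_geometric; rewrite ger0_norm ?invr_ge0// invf_lt1// ltr1n.
  have e3 : 0 < e / 3 by lra.
  have : \forall n \near \oo, `|0 - geometric (`|M t| + 1) (2^-1) n| < e / 3.
    by apply: cvgr_dist_lt.
  case=> N _ /(_ N (leqnn N)).
  rewrite /= sub0r normrN exprVn => HN; exists N.
  by apply: le_lt_trans HN; exact: ler_norm.
near=> s.
have h1 : `|u n t - u n s| < e / 3.
  by near: s; apply: cvgr_dist_lt; [exact: uc|lra].
have h2 : `|M t - M s| < 1.
  by near: s; apply: cvgr_dist_lt; [exact: Mc|lra].
have p2 : 0 < (2 : K) ^+ n by rewrite exprn_gt0.
have hs : `|u n s - v s| < e / 3.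
  apply: (le_lt_trans (H n s)); apply: (le_lt_trans _ Hn).
  rewrite ler_pM2r ?invr_gt0//.
  have := ler_norm (M t); move: h2; rewrite ltr_norml => /andP[]; lra.
have ht : `|u n t - v t| < e / 3.
  apply: (le_lt_trans (H n t)); apply: (le_lt_trans _ Hn).
  rewrite ler_pM2r ?invr_gt0//.
  have := ler_norm (M t); lra.
move: h1 hs ht; rewrite !ltr_norml => /andP[? ?] /andP[? ?] /andP[? ?].
by apply/andP; split; lra.
Unshelve. all: end_near. Qed.

(** Picard iteration converges on the whole line at once because [L] does not depend on [t].
    Continuity of [f] is asked only along continuous curves, which is all that the integrands
    require. *)
Theorem ivp_exists (f : K -> K -> K -> K) (L B y0 v0 : K) :
  0 <= L -> 0 <= B ->
  (forall y v : K -> K, continuous y -> continuous v ->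
     continuous (fun t => f t (y t) (v t))) ->
  (forall t y v y' v', `|f t y v - f t y' v'| <= L * (`|y - y'| + `|v - v'|)) ->
  (forall t, `|f t 0 0| <= B) ->
  exists y v : K -> K, [/\ y 0 = y0, v 0 = v0,
    forall t : K, is_derive t 1 y (v t) &
    forall t : K, is_derive t 1 v (f t (y t) (v t))].
Proof.
move=> L0 B0 fc fL fB.
(* [I] is integration from 0 made into a total operator by choice; its value at a discontinuous
   function is irrelevant. *)
have [I HI] : {I : (K -> K) -> K -> K & forall g : K -> K, continuous g ->
    I g 0 = 0 /\ forall t : K, is_derive t 1 (I g) (g t)}.
  apply: (choice (P := fun g P => continuous g -> P 0 = 0 /\
    forall t : K, is_derive t 1 P (g t))) => g.
  have [gc|ngc] := pselect (continuous g); last by exists g => /ngc.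
  by have [P HP] := primitive_exists gc; exists P.
have IB k C (g h : K -> K) : 0 < k -> 0 <= C -> continuous g -> continuous h ->
    (forall t, `|g t - h t| <= C * expR (k * `|t|)) ->
    forall t, `|I g t - I h t| <= C / k * expR (k * `|t|).
  move=> k0 C0 /HI[g0 gd] /HI[h0 hd] gh.
  apply: (@primitive_bound _ (I g - I h) (g - h)) => //.
  by rewrite !fctE g0 h0 subrr.
have IBc k C (g : K -> K) : 0 < k -> 0 <= C -> continuous g ->
    (forall t, `|g t| <= C) ->
    forall t, `|I g t| <= C / k * expR (k * `|t|).
  move=> k0 C0 gc gC; have [g0 gd] := HI _ gc.
  apply: (@primitive_bound _ (I g) g) => // t; apply: (le_trans (gC t)).
  rewrite ler_peMr// -expR0 ler_expR mulr_ge0// ltW//.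
have Ic (g : K -> K) (a : K) : continuous g -> continuous (fun t => a + I g t).
  move=> gc t; have [_ gd] := HI _ gc.
  by apply: cvgD; [exact: cvg_cst|exact: is_derive_cont (gd t)].
pose T (z : (K -> K) * (K -> K)) : (K -> K) * (K -> K) :=
  (fun t => y0 + I z.2 t, fun t => v0 + I (fun s => f s (z.1 s) (z.2 s)) t).
pose Z n := iter n T (cst y0, cst v0).
have Zc n : continuous (Z n).1 /\ continuous (Z n).2.
  elim: n => [|n [IH1 IH2]]; first by split=> t; exact: cvg_cst.
  by split; apply: Ic => //; exact: fc.
(* In the sup norm weighted by exp (- k |t|), Picard iteration halves distances. *)
pose k : K := 2 * (1 + L).
have k0 : 0 < k by rewrite /k; lra.
pose E (t : K) : K := expR (k * `|t|).
pose C1 : K := B + L * (`|y0| + `|v0|).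
have C10 : 0 <= C1 by rewrite /C1 addr_ge0// mulr_ge0// addr_ge0.
(* Size of the first Picard step: the integrands [v0] and [f s y0 v0] are bounded by [|v0|] and
   [C1], and integration gains 1/k. *)
pose C : K := (`|v0| + C1) / k.
have C0 : 0 <= C by apply: divr_ge0; [exact: addr_ge0|exact: ltW].
have Zb n t : `|(Z n.+1).1 t - (Z n).1 t| + `|(Z n.+1).2 t - (Z n).2 t|
    <= C / 2 ^+ n * E t.
  elim: n t => [|n IH] t.
    rewrite expr0 divr1 /= ![_ + _ - _]addrAC !subrr !add0r.
    have -> : C * E t = `|v0| / k * E t + C1 / k * E t by rewrite /C; ring.
    apply: lerD; apply: IBc => //.
    - by move=> s; exact: cvg_cst.
    - by apply: fc => s; exact: cvg_cst.
    - move=> s /=; have := fL s y0 v0 0 0; rewrite !subr0 => h.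
      have -> : f s y0 v0 = (f s y0 v0 - f s 0 0) + f s 0 0 by ring.
      by apply: (le_trans (ler_normD _ _)); rewrite /C1 addrC lerD.
  have [c1 c2] := Zc n; have [c3 c4] := Zc n.+1.
  have p2 : 0 <= C / 2 ^+ n by rewrite divr_ge0// exprn_ge0.
  have -> : (Z n.+2).1 t - (Z n.+1).1 t = I (Z n.+1).2 t - I (Z n).2 t.
    by rewrite /=; ring.
  have -> : (Z n.+2).2 t - (Z n.+1).2 t =
      I (fun s => f s ((Z n.+1).1 s) ((Z n.+1).2 s)) t
      - I (fun s => f s ((Z n).1 s) ((Z n).2 s)) t.
    by rewrite /=; ring.
  (* The choice of [k]: the first component contributes 1/k and the second L/k, which add up to
     1/2. *)
  have -> : C / 2 ^+ n.+1 * E t =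
      C / 2 ^+ n / k * E t + (L * (C / 2 ^+ n)) / k * E t.
    rewrite exprS /k; field; rewrite expf_neq0//= lt0r_neq0//; lra.
  apply: lerD; apply: IB => //.
  - by move=> s; apply: le_trans (IH s); rewrite lerDr.
  - exact: mulr_ge0.
  - exact: fc.
  - exact: fc.
  - by move=> s; apply: (le_trans (fL _ _ _ _ _)); rewrite -mulrA ler_wpM2l.
have lim1 t : exists l, forall n, `|(Z n).1 t - l| <= 2 * (C * E t) / 2 ^+ n.
  apply: geometric_cauchy_lim => n; rewrite mulrAC.
  by apply: le_trans (Zb n t); rewrite lerDl.
have lim2 t : exists l, forall n, `|(Z n).2 t - l| <= 2 * (C * E t) / 2 ^+ n.
  apply: geometric_cauchy_lim => n; rewrite mulrAC.
  by apply: le_trans (Zb n t); rewrite lerDr.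
have [y Hy] := choice lim1; have [v Hv] := choice lim2.
have Ec : continuous E.
  move=> t; apply: (@continuous_comp _ _ _ (fun t : K => k * `|t|) expR).
    by apply: cvgM; [exact: cvg_cst|exact: norm_continuous].
  exact: continuous_expR.
have Mc : continuous (fun t => 2 * (C * E t)).
  by move=> t; do 2 (apply: cvgM; first exact: cvg_cst); exact: Ec.
have yc : continuous y.
  by apply: (continuous_geometric_lim (fun n => (Zc n).1) Mc) => n t; exact: Hy.
have vc : continuous v.
  by apply: (continuous_geometric_lim (fun n => (Zc n).2) Mc) => n t; exact: Hv.
(* Passage to the limit in the integral equation: both errors decay like 2^-n in the weighted norm,
   so the two sides are equal. *)
have pass (w g : K -> K) (gn : nat -> K -> K) (a A : K) : 0 <= A ->
    continuous g -> (forall n, continuous (gn n)) ->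
    (forall n t, `|a + I (gn n) t - w t| <= 2 * (C * E t) / 2 ^+ n.+1) ->
    (forall n t, `|gn n t - g t| <= A / 2 ^+ n * E t) ->
    w = fun t => a + I g t.
  move=> A0 gc gnc Hw Hg; apply/funext => t; apply/eqP; rewrite -subr_eq0.
  apply/eqP; apply: (@le_geometric_eq0 _ ((C + A / k) * E t)) => n.
  have -> : w t - (a + I g t) =
     - (a + I (gn n) t - w t) + (I (gn n) t - I g t) by ring.
  have An : 0 <= A / 2 ^+ n by rewrite divr_ge0// exprn_ge0.
  have -> : (C + A / k) * E t / 2 ^+ n =
     2 * (C * E t) / 2 ^+ n.+1 + A / 2 ^+ n / k * E t.
    by rewrite exprS; field; rewrite expf_neq0//= lt0r_neq0.
  apply: (le_trans (ler_normD _ _)); rewrite normrN; apply: lerD => //.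
  exact: IB.
have yE : y = fun t => y0 + I v t.
  apply: (pass _ _ (fun n => (Z n).2) _ (2 * C)) => //.
  - exact: mulr_ge0.
  - by move=> n; exact: (Zc n).2.
  - by move=> n t; exact: (Hy t n.+1).
  - by move=> n t; apply: (le_trans (Hv t n)); rewrite mulrA mulrAC.
have fyc := fc _ _ yc vc.
have vE : v = fun t => v0 + I (fun s => f s (y s) (v s)) t.
  apply: (pass _ _ (fun n s => f s ((Z n).1 s) ((Z n).2 s)) _ (L * (4 * C))) => //.
  - by apply: mulr_ge0 => //; apply: mulr_ge0.
  - by move=> n; apply: fc; [exact: (Zc n).1|exact: (Zc n).2].
  - by move=> n t; exact: (Hv t n.+1).
  - move=> n t; apply: (le_trans (fL _ _ _ _ _)).
    rewrite -2!mulrA ler_wpM2l//; have := Hy t n; have := Hv t n; lra.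
exists y, v; split.
- by rewrite yE (HI _ vc).1 addr0.
- by rewrite vE (HI _ fyc).1 addr0.
- move=> t; rewrite {1}yE -[v t]add0r; apply: is_deriveD.
  exact: (HI _ vc).2.
- move=> t; rewrite {1}vE -[f t _ _]add0r; apply: is_deriveD.
  exact: (HI _ fyc).2.
Qed.

End Picard.

(** * Brouwer's theorem in the plane *)

Section DiscreteBrouwer.

(** [H] and [V] are values on horizontal and vertical edges. The circulations around the unit
    squares add up to that around the large square, as each inner edge is run through once in each
    direction. *)
Lemma discrete_green (n : nat) (H V : nat -> nat -> int) :
  \sum_(0 <= i < n) \sum_(0 <= j < n)
     (H i j + V i.+1 j - H i j.+1 - V i j) =
  \sum_(0 <= i < n) (H i 0%N - H i n) + \sum_(0 <= j < n) (V n j - V 0%N j).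
Proof.
have -> : \sum_(0 <= i < n) \sum_(0 <= j < n) (H i j + V i.+1 j - H i j.+1 - V i j)
  = \sum_(0 <= i < n) \sum_(0 <= j < n) (H i j - H i j.+1)
  + \sum_(0 <= j < n) \sum_(0 <= i < n) (V i.+1 j - V i j).
  rewrite [X in _ + X]exchange_big -big_split; apply: eq_bigr => i _.
  by rewrite -big_split; apply: eq_bigr => j _ /=; ring.
congr (_ + _); apply: eq_bigr => i _; last by rewrite telescope_sumr.
under eq_bigr do rewrite -opprB.
by rewrite sumrN telescope_sumr// opprB.
Qed.

(* The labels are A, B and "neither".  [e] counts the edges from an A to a B
   with sign: it sums to zero around a square lacking one of the labels, and
   to one around the boundary. *)
Lemma sperner_square (n : nat) (A B : nat -> nat -> bool) :
  (forall i j, ~~ (A i j && B i j)) ->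
  A 0%N 0%N -> (forall i, A i 0%N || B i 0%N) -> (forall j, B n j) ->
  (forall i, ~~ A i n) -> (forall j, ~~ B 0%N j) ->
  exists i j, [/\ (i < n)%N, (j < n)%N,
    exists u : bool * bool, A (i + u.1)%N (j + u.2)%N,
    exists u : bool * bool, B (i + u.1)%N (j + u.2)%N &
    exists u : bool * bool,
      ~~ A (i + u.1)%N (j + u.2)%N && ~~ B (i + u.1)%N (j + u.2)%N].
Proof.
move=> AB A00 bot right top left.
pose e i j i' j' : int :=
  (A i j)%:R * (B i' j')%:R - (B i j)%:R * (A i' j')%:R.
apply: contrapT => Hn.
have := discrete_green n (fun i j => e i j i.+1 j) (fun i j => e i j i j.+1).
(* If no square carries all three labels, every circulation vanishes, by inspection of the
   labellings of the four corners. *)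
rewrite [LHS]big_nat_cond big1; last first.
  move=> i /andP[/andP[_ iltn] _]; rewrite big_nat_cond big1// => j /andP[/andP[_ jltn] _].
  have Hc (P : nat -> nat -> bool) : (exists u : bool * bool, P (i + u.1)%N (j + u.2)%N) <->
      [|| P i j, P i.+1 j, P i j.+1 | P i.+1 j.+1].
    split=> [[[[] []]]/=|]; rewrite ?addn0 ?addn1.
    - by move=> ->; rewrite !orbT.
    - by move=> ->; rewrite !orbT.
    - by move=> ->; rewrite !orbT.
    - by move=> ->.
    - by case/or4P=> h; [exists (false, false)|exists (true, false)
        |exists (false, true)|exists (true, true)]; rewrite /= ?addn0 ?addn1.
  have : ~ [/\ [|| A i j, A i.+1 j, A i j.+1 | A i.+1 j.+1],
     [|| B i j, B i.+1 j, B i j.+1 | B i.+1 j.+1] &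
     [|| ~~ A i j && ~~ B i j, ~~ A i.+1 j && ~~ B i.+1 j,
         ~~ A i j.+1 && ~~ B i j.+1 | ~~ A i.+1 j.+1 && ~~ B i.+1 j.+1]].
    move=> [/Hc h1 /Hc h2 /(Hc (fun i j => ~~ A i j && ~~ B i j)) h3].
    by apply: Hn; exists i, j; split.
  rewrite /e; move: (AB i j) (AB i.+1 j) (AB i j.+1) (AB i.+1 j.+1).
  case: (A i j) (B i j) (A i.+1 j) (B i.+1 j) (A i j.+1) (B i j.+1)
    (A i.+1 j.+1) (B i.+1 j.+1) => [] // [] [] // [] [] // [] [] //=;
    case=> // _ _ _ _ h; first [reflexivity|by exfalso; apply: h; split].
(* The right side carries no A and the left side no B, so their edges count for nothing. *)
have -> : \sum_(0 <= j < n) (e n j n j.+1 - e 0%N j 0%N j.+1) = 0.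
  apply: big1 => j _; rewrite /e !right !(negbTE (left _)).
  have nA k : A n k = false by have := AB n k; rewrite right andbT => /negbTE.
  by rewrite !nA; case: (A 0%N j); case: (A 0%N j.+1).
(* The top carries no A. Along the bottom each vertex is A or B, so [e] is the increment of the
   indicator of B; it telescopes to 1, against 0 from the squares. *)
have -> : \sum_(0 <= i < n) (e i 0%N i.+1 0%N - e i n i.+1 n) =
  \sum_(0 <= i < n) ((B i.+1 0%N)%:R - (B i 0%N)%:R).
  apply: eq_bigr => i _; rewrite /e !(negbTE (top _)).
  move: (AB i 0%N) (AB i.+1 0%N) (bot i) (bot i.+1).
  case: (A i 0%N) (B i 0%N) (A i.+1 0%N) (B i.+1 0%N) => [] [] [] [] // _ _ _ _;
    by case: (B i n) (B i.+1 n) => [] [].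
by rewrite telescope_sumr// right (negbTE (left _)).
Qed.

End DiscreteBrouwer.

Section Brouwer.
Context {K : realType}.

(** In a grid square with all three labels, both displacements are nonnegative at the corner
    labelled A, and each is negative at some other corner. By the Lipschitz bound both are then
    small at the A corner. *)
Lemma approx_fixpoint_square (g1 g2 : K -> K -> K) (C L eps : K) :
  0 < C -> 0 <= L -> 0 < eps ->
  (forall x y, `|g1 x y| < C) -> (forall x y, `|g2 x y| < C) ->
  (forall x y x' y', `|g1 x y - g1 x' y'| <= L * (`|x - x'| + `|y - y'|)) ->
  (forall x y x' y', `|g2 x y - g2 x' y'| <= L * (`|x - x'| + `|y - y'|)) ->
  exists x y, [/\ `|x| <= C, `|y| <= C, `|g1 x y - x| <= eps & `|g2 x y - y| <= eps].
Proof.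
move=> C0 L0 eps0 g1C g2C g1L g2L.
(* Across a square of mesh [h = 2 * C / n] a displacement varies by at most [2 * h * L + h], hence
   by at most [4 * C * (L + 1) / n]. *)
pose n := (Num.trunc (4 * C * (L + 1) / eps)).+1.
have n0 : 0 < (n%:R : K) by rewrite ltr0n.
have nE : 4 * C * (L + 1) / n%:R <= eps.
  rewrite ler_pdivrMr// -ler_pdivrMl// mulrC ltW//; exact: truncnS_gt.
pose h : K := 2 * C / n%:R.
have h0 : 0 < h by rewrite divr_gt0// mulr_gt0.
pose x (i : nat) : K := - C + h * i%:R.
have xn : x n = C by rewrite /x /h divfK ?lt0r_neq0//; ring.
have x0 : x 0%N = - C by rewrite /x mulr0 addr0.
have xC i : (i <= n)%N -> `|x i| <= C.
  move=> iln; rewrite ler_norml; apply/andP; split.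
    by rewrite /x lerDl mulr_ge0// ltW.
  by rewrite -[leRHS]xn /x lerD2l ler_pM2l// ler_nat.
have xd i (u v : bool) : `|x (i + u)%N - x (i + v)%N| <= h.
  have -> : x (i + u)%N - x (i + v)%N = h * (u%:R - v%:R).
    by rewrite /x !natrD; ring.
  rewrite normrM (gtr0_norm h0) ler_piMr ?(ltW h0)//.
  by case: u; case: v; rewrite ?subrr ?normr0 ?subr0 ?sub0r ?normrN ?normr1.
pose d1 i j := g1 (x i) (x j) - x i.
pose d2 i j := g2 (x i) (x j) - x j.
(* The third label means [0 <= d1] and [d2 < 0]. The strict bounds on [g1] and [g2] make the
   displacement point inwards on the boundary, which gives the boundary conditions on labels. *)
pose A i j := (0 <= d1 i j) && (0 <= d2 i j).
pose B i j := d1 i j < 0.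
have bnd (g : K -> K -> K) (gC : forall x y, `|g x y| < C) s t : - C < g s t < C.
  by rewrite -ltr_norml.
have [||||||i [j [iln jln [u uA] [v vB] [w]]]] := @sperner_square n A B.
- by move=> i j; rewrite /A /B; case: (leP 0 (d1 i j)); rewrite ?andbF.
- rewrite /A /d1 /d2 x0; move/andP: (bnd _ g1C (- C) (- C)) => [? ?].
  move/andP: (bnd _ g2C (- C) (- C)) => [? ?].
  by apply/andP; split; lra.
- move=> i; rewrite /A /B; case: (leP 0 (d1 i 0%N)) => //= _; rewrite orbF /d2 x0.
  by move/andP: (bnd _ g2C (x i) (- C)) => [? ?]; lra.
- move=> j; rewrite /B /d1 xn.
  by move/andP: (bnd _ g1C C (x j)) => [? ?]; lra.
- move=> i; rewrite /A negb_and -!ltNge /d2 xn; apply/orP; right.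
  by move/andP: (bnd _ g2C (x i) C) => [? ?]; lra.
- move=> j; rewrite /B -leNgt /d1 x0.
  by move/andP: (bnd _ g1C (- C) (x j)) => [? ?]; lra.
rewrite /A /B -leNgt negb_and -!ltNge.
case: (leP 0 (d1 (i + w.1)%N (j + w.2)%N)) => //= d1w; rewrite andbT => d2w.
have hE : 2 * h * (L + 1) <= eps.
  by apply: le_trans nE; rewrite le_eqVlt; apply/orP; left; apply/eqP; rewrite /h; field; exact: lt0r_neq0.
have Ld (g : K -> K -> K) (gL : forall x y x' y', `|g x y - g x' y'| <= L * (`|x - x'| + `|y - y'|))
   (a b : bool * bool) :
   g (x (i + a.1)%N) (x (j + a.2)%N) - g (x (i + b.1)%N) (x (j + b.2)%N) <= 2 * h * L.
  apply: (le_trans (ler_norm _)); apply: (le_trans (gL _ _ _ _)).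
  rewrite [leRHS]mulrC ler_wpM2l//; have := xd i a.1 b.1; have := xd j a.2 b.2; lra.
move/andP: uA => [uA1 uA2].
have iu : (i + u.1 <= n)%N by rewrite (leq_trans _ iln)// -addn1 leq_add2l leq_b1.
have ju : (j + u.2 <= n)%N by rewrite (leq_trans _ jln)// -addn1 leq_add2l leq_b1.
exists (x (i + u.1)%N), (x (j + u.2)%N); split; rewrite ?xC//.
- rewrite -/(d1 _ _) ger0_norm//.
  have := Ld _ g1L u v; have := xd i u.1 v.1; rewrite ler_norml => /andP[].
  move: vB; rewrite /B /d1 => *; lra.
- rewrite -/(d2 _ _) ger0_norm//.
  have := Ld _ g2L u w; have := xd j u.2 w.2; rewrite ler_norml => /andP[].
  move: d2w; rewrite /d2 => *; lra.
Qed.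

(** By compactness the total displacement attains its minimum on the square, and approximate fixed
    points force that minimum to be 0. *)
Theorem lipschitz_fixpoint_plane (g1 g2 : K -> K -> K) (C L : K) :
  0 < C -> 0 <= L ->
  (forall x y, `|g1 x y| < C) -> (forall x y, `|g2 x y| < C) ->
  (forall x y x' y', `|g1 x y - g1 x' y'| <= L * (`|x - x'| + `|y - y'|)) ->
  (forall x y x' y', `|g2 x y - g2 x' y'| <= L * (`|x - x'| + `|y - y'|)) ->
  exists x y, g1 x y = x /\ g2 x y = y.
Proof.
move=> C0 L0 g1C g2C g1L g2L.
pose Q : set (K * K) := `[- C, C] `*` `[- C, C].
pose F (z : K * K) : K := `|g1 z.1 z.2 - z.1| + `|g2 z.1 z.2 - z.2|.
have f1 : continuous (@fst K K) by move=> z; exact: cvg_fst.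
have f2 : continuous (@snd K K) by move=> z; exact: cvg_snd.
have gc1 := lipschitz2_comp_continuous L0 g1L f1 f2.
have gc2 := lipschitz2_comp_continuous L0 g2L f1 f2.
have Fc : continuous F.
  by move=> z; apply: cvgD; apply: cvg_norm; apply: cvgB;
    [exact: gc1|exact: cvg_fst|exact: gc2|exact: cvg_snd].
have Q0 : Q !=set0.
  by exists (0, 0); split; rewrite /= in_itv/=; apply/andP; split; lra.
have Qc : compact Q by apply: compact_setX; exact: segment_compact.
have [c _ Hc] := compact_EVT_min Q0 Qc (continuous_subspaceT Fc).
have Fc0 : F c <= 0.
  apply/ler_addgt0Pr => e e0; rewrite add0r.
  have e2 : 0 < e / 2 by lra.
  have [x [y [xC yC h1 h2]]] := approx_fixpoint_square C0 L0 e2 g1C g2C g1L g2L.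
  have := Hc (x, y); rewrite inE /Q /= !in_itv/= -!ler_norml => /(_ (conj xC yC)).
  by rewrite /F /= in h1 h2 *; lra.
have n1 := normr_ge0 (g1 c.1 c.2 - c.1); have n2 := normr_ge0 (g2 c.1 c.2 - c.2).
exists c.1, c.2; split; apply/eqP; rewrite -subr_eq0 -normr_le0; move: Fc0; rewrite /F; lra.
Qed.

End Brouwer.

(** * Periodic solutions with a bounded nonlinearity *)

Section PeriodicBasics.
Context {K : realType}.

Lemma periodicz (f : K -> K) (w : K) : periodic f w ->
  forall (n : int) t, f (t + w *~ n) = f t.
Proof.
move=> fw [n|n] t; first by rewrite -pmulrn periodicn.
by rewrite NegzE mulrNz -pmulrn -[LHS](periodicn fw n.+1) subrK.
Qed.

Lemma period_reduce (w t : K) : 0 < w ->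
  exists n : int, 0 <= t + w *~ n < w.
Proof.
move=> w0; exists (- Num.floor (t / w)).
have /andP[h1 h2] := floor_itv (t / w).
rewrite mulrNz -mulrzr.
move: h1; rewrite ler_pdivlMr// => h1.
move: h2; rewrite ltr_pdivrMr// intrD => h2.
apply/andP; split; lra.
Qed.

Lemma periodic_bounded (f : K -> K) (w : K) : 0 < w -> continuous f ->
  periodic f w -> exists B, 0 <= B /\ forall t, `|f t| <= B.
Proof.
move=> w0 fc fw.
have nc : {within `[0, w], continuous (fun t => `|f t|)}.
  by apply: continuous_subspaceT => t; apply: cvg_norm; exact: fc.
have [c _ Hc] := EVT_max (ltW w0) nc.
exists `|f c|; split=> // t; have [n /andP[n0 nw]] := period_reduce t w0.
rewrite -(periodicz fw n t); apply: Hc.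
by rewrite in_itv/= n0 ltW.
Qed.

Lemma periodic_derive (y v : K -> K) (w : K) : periodic y w ->
  (forall t : K, is_derive t 1 y (v t)) -> periodic v w.
Proof.
move=> yw yd t; have h1 := is_derive_translate (yd (t + w)).
rewrite (_ : (fun s => y (s + w)) = y) in h1; last first.
  by apply/funext => s; rewrite yw.
by have [_ <-] := h1; have [_ ->] := yd t.
Qed.

End PeriodicBasics.

(** * Gronwall's inequality for second-order equations *)

Section Gronwall.
Context {K : realType}.

(** Squares are differentiable where absolute values are not. Including [M ^+ 2] in the energy
    absorbs the forcing through 2|w|M ≤ w² + M²; the largest coefficient in the derivative of the
    energy is then 2 + 3L, that of w². *)
Lemma gronwall_sqr (d w g : K -> K) (L M : K) : 0 <= L ->
  (forall t : K, is_derive t 1 d (w t)) ->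
  (forall t : K, is_derive t 1 w (g t)) ->
  (forall t, `|g t| <= L * (`|d t| + `|w t|) + M) ->
  forall t, 0 <= t -> d t ^+ 2 + w t ^+ 2 + M ^+ 2 <=
    (d 0 ^+ 2 + w 0 ^+ 2 + M ^+ 2) * expR ((2 + 3 * L) * t).
Proof.
move=> L0 dd wd gb t t0.
pose k : K := 2 + 3 * L.
pose phi (t : K) := d t ^+ 2 + w t ^+ 2 + M ^+ 2.
pose psi (t : K) := phi t * expR (- k * t).
have psid (s : K) : is_derive s 1 psi
    ((2 * d s * w s + 2 * w s * g s - k * phi s) * expR (- k * s)).
  have h1 : is_derive s 1 (- k \*: (id : K -> K)) (- k *: (1 : K)) by exact: is_deriveZ.
  have h2 := @is_derive1_comp K expR (- k \*: (id : K -> K)) s _ _ (is_derive_expR _) h1.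
  have ds := dd s; have ws := wd s.
  have h3 : is_derive s 1 (d * d + w * w + cst (M ^+ 2))
    (d s *: w s + d s *: w s + (w s *: g s + w s *: g s) + 0).
    by apply: is_deriveD.
  have h4 := is_deriveM h3 h2.
  apply: (@is_derive_eq _ _ _ _ _ _ _ _ h4).
  by rewrite /phi /GRing.scale/= !fctE; ring.
have psi_le : psi t <= cst (psi 0) t.
  apply: (@derive_le _ psi _ _ (cst 0) 0 psid _ _ _ t t0) => // s _ /=.
  rewrite pmulr_lle0 ?expR_gt0// subr_le0.
  have hg : `|w s| * `|g s| <= `|w s| * (L * (`|d s| + `|w s|) + M).
    by rewrite ler_wpM2l.
  have h1 : d s * w s <= `|d s| * `|w s| by rewrite -normrM ler_norm.
  have h2 : w s * g s <= `|w s| * `|g s| by rewrite -normrM ler_norm.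
  have e1 : 0 <= (`|d s| - `|w s|) ^+ 2 by exact: sqr_ge0.
  have e2 : 0 <= (`|w s| - M) ^+ 2 by exact: sqr_ge0.
  have e3 : 0 <= L * (`|d s| - `|w s|) ^+ 2 by rewrite mulr_ge0 ?sqr_ge0.
  have e4 : 0 <= L * M ^+ 2 by rewrite mulr_ge0 ?sqr_ge0.
  have e5 : 0 <= L * `|d s| ^+ 2 by rewrite mulr_ge0 ?sqr_ge0.
  have e6 := sqr_ge0 (d s); have e7 := sqr_ge0 M; have e8 := sqr_ge0 (w s).
  rewrite /phi /k -(real_normK (num_real (d s))) -(real_normK (num_real (w s))).
  rewrite -(real_normK (num_real (d s))) in e6.
  nra.
move: psi_le; rewrite /psi /= mulr0 expR0 mulr1 -/(phi t) -/(phi 0).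
by rewrite mulNr expRN ler_pdivrMr ?expR_gt0.
Qed.

Lemma gronwall (d w g : K -> K) (L M : K) : 0 <= L -> 0 <= M ->
  (forall t : K, is_derive t 1 d (w t)) ->
  (forall t : K, is_derive t 1 w (g t)) ->
  (forall t, `|g t| <= L * (`|d t| + `|w t|) + M) ->
  forall t, 0 <= t ->
    `|d t| <= expR ((2 + 3 * L) * t) * (`|d 0| + `|w 0| + M) /\
    `|w t| <= expR ((2 + 3 * L) * t) * (`|d 0| + `|w 0| + M).
Proof.
move=> L0 M0 dd wd gb t t0.
have H := gronwall_sqr L0 dd wd gb t0.
set E := expR _ in H *.
(* Since [E <= E ^+ 2], the bound [S ^+ 2 * E] on squares becomes [(E * S) ^+ 2], of which a root
   can be taken. *)
have E1 : 1 <= E by rewrite /E -[leLHS]expR0 ler_expR mulr_ge0//; lra.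
set S := `|d 0| + `|w 0| + M.
have S0 : 0 <= S by rewrite !addr_ge0.
have HS : d 0 ^+ 2 + w 0 ^+ 2 + M ^+ 2 <= S ^+ 2.
  rewrite -(real_normK (num_real (d 0))) -(real_normK (num_real (w 0))) /S.
  have a0 := normr_ge0 (d 0); have b0 := normr_ge0 (w 0).
  have := mulr_ge0 a0 b0; have := mulr_ge0 a0 M0; have := mulr_ge0 b0 M0; nra.
have HE : d t ^+ 2 + w t ^+ 2 + M ^+ 2 <= (E * S) ^+ 2.
  apply: (le_trans H); apply: (@le_trans _ _ (S ^+ 2 * E)).
    by rewrite ler_wpM2r//; lra.
  rewrite exprMn mulrC ler_wpM2r ?sqr_ge0//; rewrite expr2 ler_peMl//; lra.
have ES : 0 <= E * S by rewrite mulr_ge0//; lra.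
have d2 := sqr_ge0 (d t); have w2 := sqr_ge0 (w t); have M2 := sqr_ge0 M.
split; rewrite -ler_sqr ?nnegrE// real_normK ?num_real//; lra.
Qed.

End Gronwall.

(** * Uniqueness, periodicity and linearity of solutions *)

Section Flow.
Context {K : realType}.
Implicit Types (f : K -> K -> K -> K) (y v p q : K -> K) (w : K).

Definition flow f y v :=
  (forall t : K, is_derive t 1 y (v t)) /\
  (forall t : K, is_derive t 1 v (f t (y t) (v t))).

Definition lipschitz2 (L : K) f := forall t (y v y' v' : K),
  `|f t y v - f t y' v'| <= L * (`|y - y'| + `|v - v'|).

Lemma flow_dist f (L : K) y1 v1 y2 v2 : 0 <= L -> lipschitz2 L f ->
  flow f y1 v1 -> flow f y2 v2 -> forall t, 0 <= t ->
  `|y1 t - y2 t| <= expR ((2 + 3 * L) * t) * (`|y1 0 - y2 0| + `|v1 0 - v2 0|) /\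
  `|v1 t - v2 t| <= expR ((2 + 3 * L) * t) * (`|y1 0 - y2 0| + `|v1 0 - v2 0|).
Proof.
move=> L0 fL [y1d v1d] [y2d v2d] t t0.
pose g (s : K) := f s (y1 s) (v1 s) - f s (y2 s) (v2 s).
have hd (s : K) : is_derive s 1 (y1 - y2) (v1 s - v2 s).
  by have := y1d s; have := y2d s => *; apply: is_deriveB.
have hw (s : K) : is_derive s 1 (v1 - v2) (g s).
  by have := v1d s; have := v2d s => *; apply: is_deriveB.
have := gronwall L0 (lexx 0) hd hw _ t0.
by rewrite addr0; apply => s; rewrite addr0; exact: fL.
Qed.

(** Time reversal changes the sign of the velocity but not of the acceleration; it carries forward
    estimates to negative times. *)
Lemma flow_reflect f y v : flow f y v ->
  flow (fun t a b => f (- t) a (- b)) (fun t => y (- t)) (fun t => - v (- t)).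
Proof.
move=> [yd vd]; split=> t; first exact: is_derive_reflect.
rewrite opprK -[f _ _ _]opprK.
by have := is_derive_reflect (vd (- t)) => ?; apply: is_deriveN.
Qed.

Lemma flow_unique f (L : K) y1 v1 y2 v2 : 0 <= L -> lipschitz2 L f ->
  flow f y1 v1 -> flow f y2 v2 -> y1 0 = y2 0 -> v1 0 = v2 0 ->
  forall t, y1 t = y2 t /\ v1 t = v2 t.
Proof.
move=> L0 fL F1 F2 y0 v0.
have pos g (z1 u1 z2 u2 : K -> K) (gL : lipschitz2 L g) : flow g z1 u1 -> flow g z2 u2 ->
    z1 0 = z2 0 -> u1 0 = u2 0 -> forall t, 0 <= t -> z1 t = z2 t /\ u1 t = u2 t.
  move=> G1 G2 z0 u0 t t0; have := flow_dist L0 gL G1 G2 t0.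
  rewrite z0 u0 !subrr !normr0 addr0 mulr0 !normr_le0 !subr_eq0.
  by case=> /eqP-> /eqP->.
move=> t; have [t0|t0] := leP 0 t; first exact: (pos f).
have t0' : 0 <= - t by lra.
have gL : lipschitz2 L (fun t a b => f (- t) a (- b)).
  move=> s a b a' b'; apply: (le_trans (fL _ _ _ _ _)).
  by rewrite -opprD normrN.
have := pos _ _ _ _ _ gL (flow_reflect F1) (flow_reflect F2) _ _ _ t0'.
rewrite !oppr0 !opprK y0 v0 => /(_ erefl erefl)[-> /oppr_inj ->].
by [].
Qed.

(** The translate by [w] solves the same equation with the same initial data, so uniqueness applies.
    Fixed points of the Poincare map thus yield periodic solutions. *)
Lemma flow_periodic f (L w : K) y v : 0 <= L -> lipschitz2 L f ->
  (forall t a b, f (t + w) a b = f t a b) ->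
  flow f y v -> y w = y 0 -> v w = v 0 -> periodic y w.
Proof.
move=> L0 fL fw F yw vw t.
have F' : flow f (fun t => y (t + w)) (fun t => v (t + w)).
  split=> s; first by apply: is_derive_translate; exact: F.1.
  by rewrite -fw; apply: is_derive_translate; exact: F.2.
by have [] := flow_unique L0 fL F' F _ _ t; rewrite ?add0r.
Qed.

Definition lin_field p q (t y v : K) := - p t * v - q t * y.

Lemma flow_lin_comb p q y1 v1 y2 v2 (a b : K) :
  flow (lin_field p q) y1 v1 -> flow (lin_field p q) y2 v2 ->
  flow (lin_field p q) (fun t => a * y1 t + b * y2 t) (fun t => a * v1 t + b * v2 t).
Proof.
move=> [y1d v1d] [y2d v2d]; split=> t.
  have h1 := y1d t; have h2 := y2d t.
  have h : is_derive t 1 (a \*: y1 + b \*: y2) (a *: v1 t + b *: v2 t).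
    by apply: is_deriveD.
  exact: h.
have h1 := v1d t; have h2 := v2d t.
have h : is_derive t 1 (a \*: v1 + b \*: v2)
    (a *: lin_field p q t (y1 t) (v1 t) + b *: lin_field p q t (y2 t) (v2 t)).
  by apply: is_deriveD.
by apply: (is_derive_eq h); rewrite /lin_field /GRing.scale/=; ring.
Qed.

End Flow.

(** * The Poincare map *)

Section PeriodicExistence.
Context {K : realType}.
Variables (w : K) (p q : K -> K) (N : K -> K -> K -> K) (LN M : K).
Hypotheses (w0 : 0 < w) (pc : continuous p) (pw : periodic p w)
  (qc : continuous q) (qw : periodic q w).
Hypothesis homog : forall y v, flow (lin_field p q) y v -> periodic y w ->
  forall t, y t = 0.
Hypotheses (LN0 : 0 <= LN) (M0 : 0 <= M) (NL : lipschitz2 LN N)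
  (NM : forall t y v, `|N t y v| <= M)
  (Nw : forall t y v, N (t + w) y v = N t y v)
  (Nc : forall y v : K -> K, continuous y -> continuous v ->
     continuous (fun t => N t (y t) (v t))).

Let f t y v := N t y v + lin_field p q t y v.

Theorem periodic_flow_exists : exists y v, flow f y v /\ periodic y w.
Proof.
have [Bp [Bp0 HBp]] := periodic_bounded w0 pc pw.
have [Bq [Bq0 HBq]] := periodic_bounded w0 qc qw.
pose L := LN + (Bp + Bq).
have L0 : 0 <= L by rewrite !addr_ge0.
have linL : lipschitz2 (Bp + Bq) (lin_field p q).
  move=> t a b a' b'; rewrite /lin_field.
  have -> : - p t * b - q t * a - (- p t * b' - q t * a') =
    - (p t * (b - b')) - q t * (a - a') by ring.
  apply: (le_trans (ler_normB _ _)); rewrite normrN !normrM.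
  have h1 : `|p t| * `|b - b'| <= Bp * `|b - b'| by rewrite ler_wpM2r.
  have h2 : `|q t| * `|a - a'| <= Bq * `|a - a'| by rewrite ler_wpM2r.
  have h3 : 0 <= Bp * `|a - a'| by rewrite mulr_ge0.
  have h4 : 0 <= Bq * `|b - b'| by rewrite mulr_ge0.
  lra.
have linL' : lipschitz2 L (lin_field p q).
  move=> t a b a' b'; apply: (le_trans (linL _ _ _ _ _)).
  by rewrite ler_wpM2r ?addr_ge0// lerDr.
have fL : lipschitz2 L f.
  move=> t a b a' b'; rewrite /f.
  have -> : N t a b + lin_field p q t a b - (N t a' b' + lin_field p q t a' b') =
   (N t a b - N t a' b') + (lin_field p q t a b - lin_field p q t a' b') by ring.
  by apply: (le_trans (ler_normD _ _)); rewrite /L mulrDl lerD.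
have linc y v : continuous y -> continuous v ->
    continuous (fun t => lin_field p q t (y t) (v t)).
  move=> yc vc t; apply: cvgB; apply: cvgM; [|exact: vc|exact: qc|exact: yc].
  by apply: cvgN; exact: pc.
have linw t a b : lin_field p q (t + w) a b = lin_field p q t a b.
  by rewrite /lin_field pw qw.
have fw t a b : f (t + w) a b = f t a b by rewrite /f Nw linw.
have lin0 t : `|lin_field p q t 0 0| <= 0.
  by rewrite /lin_field !mulr0 subrr normr0.
have f0 t : `|f t 0 0| <= M.
  by rewrite /f /lin_field !mulr0 subrr addr0.
have fc y v : continuous y -> continuous v -> continuous (fun t => f t (y t) (v t)).
  by move=> yc vc t; apply: cvgD; [exact: Nc|exact: linc].
(* [(a, a')] and [(b, b')] form the fundamental system, so their values at [w] are the columns of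
   Phi; [D] below is the determinant of id - Phi. *)
have [a [a' [a0 a'0 ad a'd]]] := ivp_exists 1 0 L0 (lexx 0) linc linL' lin0.
have [b [b' [b0 b'0 bd b'd]]] := ivp_exists 0 1 L0 (lexx 0) linc linL' lin0.
have Fa : flow (lin_field p q) a a' by [].
have Fb : flow (lin_field p q) b b' by [].
pose D := (1 - a w) * (1 - b' w) - b w * a' w.
(* A kernel vector of id - Phi is the initial value of a periodic solution of
   the homogeneous equation. *)
have Dn0 : D != 0.
  apply/eqP => D0.
  have key x1 x2 : (1 - a w) * x1 = b w * x2 -> a' w * x1 = (1 - b' w) * x2 ->
      x1 = 0 /\ x2 = 0.
    move=> e1 e2; have Fx := flow_lin_comb x1 x2 Fa Fb.
    have xw : periodic (fun t => x1 * a t + x2 * b t) w.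
      apply: (flow_periodic L0 linL' linw Fx).
        by rewrite a0 b0; lra.
      by rewrite a'0 b'0; lra.
    have y0 := homog Fx xw.
    have x10 : x1 = 0 by have := y0 0; rewrite a0 b0 mulr1 mulr0 addr0.
    split=> //.
    have := Fx.1 0; rewrite a'0 b'0 mulr0 add0r mulr1.
    rewrite (_ : (fun _ => _) = cst 0); last by apply/funext => t; exact: y0.
    by move=> /@derive_val <-; rewrite derive_cst.
  (* When [D = 0], the columns (1 - b', a') and (b, 1 - a) of the adjugate lie in the kernel, hence
     vanish. Then 1 - a = a' = 0, so (1, 0) is a nonzero kernel vector. *)
  have [] := key (1 - b' w) (a' w) _ _; [by move: D0; rewrite /D; lra|ring|].
  move=> e1 e2; have [] := key 1 0 _ _; last by move/eqP; rewrite oner_eq0.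
  - have [] := key (b w) (1 - a w) _ _; [ring|by move: D0; rewrite /D; lra|].
    by move=> _ ->; rewrite !(mul0r, mulr0).
  - by rewrite e2; ring.
have sol z : {yv : (K -> K) * (K -> K) |
    [/\ flow f yv.1 yv.2, yv.1 0 = z.1 & yv.2 0 = z.2]}.
  apply: cid; have [y [v [y0 v0 yd vd]]] := ivp_exists z.1 z.2 L0 M0 fc fL f0.
  by exists (y, v).
pose Y (z1 z2 : K) := (projT1 (sol (z1, z2))).1.
pose V (z1 z2 : K) := (projT1 (sol (z1, z2))).2.
have YV z1 z2 : [/\ flow f (Y z1 z2) (V z1 z2), Y z1 z2 0 = z1 & V z1 z2 0 = z2].
  exact: (projT2 (sol (z1, z2))).
clearbody Y V; clear sol.
pose E := expR ((2 + 3 * L) * w).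
have E0 : 0 <= E by exact: expR_ge0.
(* [n1] and [n2] are the components of P - Phi. The nonlinear and linear solutions start from the
   same point and differ by a response to the bounded forcing [N], so Gronwall bounds [n1] and [n2]
   independently of that point. *)
pose n1 z1 z2 := Y z1 z2 w - (z1 * a w + z2 * b w).
pose n2 z1 z2 := V z1 z2 w - (z1 * a' w + z2 * b' w).
have nb z1 z2 : `|n1 z1 z2| <= E * M /\ `|n2 z1 z2| <= E * M.
  have [[Yd Vd] Y0 V0] := YV z1 z2.
  have [ld ld'] := flow_lin_comb z1 z2 Fa Fb.
  set l := (fun t => z1 * a t + z2 * b t) in ld ld'.
  set l' := (fun t => z1 * a' t + z2 * b' t) in ld ld'.
  have hd (t : K) : is_derive t 1 (Y z1 z2 - l) (V z1 z2 t - l' t).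
    by have := Yd t; have := ld t => *; apply: is_deriveB.
  have hw (t : K) : is_derive t 1 (V z1 z2 - l')
      (f t (Y z1 z2 t) (V z1 z2 t) - lin_field p q t (l t) (l' t)).
    by have := Vd t; have := ld' t => *; apply: is_deriveB.
  have := gronwall L0 M0 hd hw _ (ltW w0).
  rewrite !fctE Y0 V0 /l /l' a0 b0 a'0 b'0 !mulr1 !mulr0 addr0 add0r !subrr normr0 !add0r.
  apply => t.
  rewrite -/(l t) /f; have -> : forall u x y' : K, u + x - y' = (x - y') + u by move=> *; ring.
  apply: (le_trans (ler_normD _ _)).
  by apply: lerD; [exact: linL'|exact: NM].
(* [E] is a Lipschitz constant of the Poincare map; the entries of Phi account for the linear
   part. *)
pose Lam := E + (`|a w| + `|b w| + `|a' w| + `|b' w|).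
have nL z1 z2 x1 x2 : `|n1 z1 z2 - n1 x1 x2| <= Lam * (`|z1 - x1| + `|z2 - x2|) /\
    `|n2 z1 z2 - n2 x1 x2| <= Lam * (`|z1 - x1| + `|z2 - x2|).
  have [Fz Y0 V0] := YV z1 z2; have [Fx Y0' V0'] := YV x1 x2.
  have := flow_dist L0 fL Fz Fx (ltW w0); rewrite Y0 Y0' V0 V0' -/E => -[h1 h2].
  have e1 := normr_ge0 (z1 - x1); have e2 := normr_ge0 (z2 - x2).
  have aux (c d k l e : K) : `|k| <= E * (`|z1 - x1| + `|z2 - x2|) ->
      `|c| + `|d| <= Lam - E ->
      `|k - (c * (z1 - x1) + d * (z2 - x2))| <= Lam * (`|z1 - x1| + `|z2 - x2|).
    move=> hk hcd; apply: (le_trans (ler_normB _ _)).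
    apply: (le_trans (lerD hk (ler_normD _ _))); rewrite !normrM.
    have c0 := normr_ge0 c; have d0 := normr_ge0 d.
    have := mulr_ge0 c0 e2; have := mulr_ge0 d0 e1.
    have : (`|c| + `|d|) * (`|z1 - x1| + `|z2 - x2|) <=
       (Lam - E) * (`|z1 - x1| + `|z2 - x2|) by rewrite ler_wpM2r// addr_ge0.
    by lra.
  have na := normr_ge0 (a w); have nb' := normr_ge0 (b w).
  have na' := normr_ge0 (a' w); have nb'' := normr_ge0 (b' w).
  split.
  - have -> : n1 z1 z2 - n1 x1 x2 = (Y z1 z2 w - Y x1 x2 w) -
      (a w * (z1 - x1) + b w * (z2 - x2)) by rewrite /n1; ring.
    by apply: aux => //; rewrite /Lam; lra.
  - have -> : n2 z1 z2 - n2 x1 x2 = (V z1 z2 w - V x1 x2 w) -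
      (a' w * (z1 - x1) + b' w * (z2 - x2)) by rewrite /n2; ring.
    by apply: aux => //; rewrite /Lam; lra.
have Lam0 : 0 <= Lam by rewrite /Lam !addr_ge0.
(* Cramer's formula for (id - Phi)^-1 applied to [(n1, n2)]. *)
pose g1 z1 z2 := ((1 - b' w) / D) * n1 z1 z2 + (b w / D) * n2 z1 z2.
pose g2 z1 z2 := (a' w / D) * n1 z1 z2 + ((1 - a w) / D) * n2 z1 z2.
pose S := `|(1 - b' w) / D| + `|b w / D| + `|a' w / D| + `|(1 - a w) / D|.
have S0 : 0 <= S by rewrite !addr_ge0.
have comb (c d x y m : K) : `|c| + `|d| <= S -> `|x| <= m -> `|y| <= m ->
    `|c * x + d * y| <= S * m.
  move=> cd xm ym; apply: (le_trans (ler_normD _ _)); rewrite !normrM.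
  have m0 : 0 <= m by exact: le_trans (normr_ge0 _) xm.
  have h1 : `|c| * `|x| <= `|c| * m by rewrite ler_wpM2l.
  have h2 : `|d| * `|y| <= `|d| * m by rewrite ler_wpM2l.
  have h3 : (`|c| + `|d|) * m <= S * m by rewrite ler_wpM2r.
  lra.
have hS1 : `|(1 - b' w) / D| + `|b w / D| <= S.
  by rewrite /S -addrA lerDl addr_ge0.
have hS2 : `|a' w / D| + `|(1 - a w) / D| <= S.
  by rewrite /S -[leRHS]addrA lerDr addr_ge0.
have g1b x y : `|g1 x y| < S * (E * M) + 1.
  have [h1 h2] := nb x y; apply: (le_lt_trans (comb _ _ _ _ _ hS1 h1 h2)).
  by rewrite ltrDl.
have g2b x y : `|g2 x y| < S * (E * M) + 1.
  have [h1 h2] := nb x y; apply: (le_lt_trans (comb _ _ _ _ _ hS2 h1 h2)).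
  by rewrite ltrDl.
have C0 : 0 < S * (E * M) + 1 by apply: le_lt_trans (g1b 0 0).
have g1L x y x' y' : `|g1 x y - g1 x' y'| <= S * Lam * (`|x - x'| + `|y - y'|).
  have [h1 h2] := nL x y x' y'; rewrite -mulrA.
  have -> : g1 x y - g1 x' y' = ((1 - b' w) / D) * (n1 x y - n1 x' y') +
    (b w / D) * (n2 x y - n2 x' y') by rewrite /g1; ring.
  exact: comb.
have g2L x y x' y' : `|g2 x y - g2 x' y'| <= S * Lam * (`|x - x'| + `|y - y'|).
  have [h1 h2] := nL x y x' y'; rewrite -mulrA.
  have -> : g2 x y - g2 x' y' = (a' w / D) * (n1 x y - n1 x' y') +
    ((1 - a w) / D) * (n2 x y - n2 x' y') by rewrite /g2; ring.
  exact: comb.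
have [z1 [z2 [E1 E2]]] :=
  lipschitz_fixpoint_plane C0 (mulr_ge0 S0 Lam0) g1b g2b g1L g2L.
have [Fz Y0 V0] := YV z1 z2.
exists (Y z1 z2), (V z1 z2); split=> //.
(* Applying id - Phi to the fixed point equation gives P z - Phi z = z - Phi z, that is, P z = z. *)
apply: (flow_periodic L0 fL fw Fz); rewrite ?Y0 ?V0.
- have : n1 z1 z2 = (1 - a w) * g1 z1 z2 - b w * g2 z1 z2.
    by rewrite /g1 /g2; move: Dn0; rewrite /D => Dn0; field.
  by rewrite E1 E2 /n1; lra.
- have : n2 z1 z2 = (1 - b' w) * g2 z1 z2 - a' w * g1 z1 z2.
    by rewrite /g1 /g2; move: Dn0; rewrite /D => Dn0; field.
  by rewrite E1 E2 /n2; lra.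
Qed.

End PeriodicExistence.

(** * Estimates from the Green's function *)

Section Extrema.
Context {K : realType}.

Lemma compact_image_bounds (T : topologicalType) (A : set T) (f : T -> K) :
  A !=set0 -> compact A -> {within A, continuous f} ->
  [/\ forall x, A x -> inf (f @` A) <= f x,
      forall x, A x -> f x <= sup (f @` A) &
      exists2 x, A x & inf (f @` A) = f x].
Proof.
move=> A0 cA cf.
have [c cA' Hc] := compact_EVT_min A0 cA cf.
have [C _ HC] := compact_EVT_max A0 cA cf.
rewrite inE in cA'.
have lb : lbound (f @` A) (f c) by move=> _ [x Ax <-]; apply: Hc; rewrite inE.
have inf_le x : A x -> inf (f @` A) <= f x.
  by move=> Ax; apply: ge_inf; [exists (f c)|exists x].
split=> //.
- move=> x Ax; apply: ub_le_sup; last by exists x.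
  by exists (f C) => _ [z Az <-]; apply: HC; rewrite inE.
- exists c => //; apply/eqP; rewrite eq_le inf_le//=.
  by apply: lb_le_inf => //; exists (f c); exists c.
Qed.

Lemma per_extrema (w : K) (f : K -> K) : 0 < w -> continuous f -> periodic f w ->
  (forall t, per_min w f <= f t) /\ exists t, per_min w f = f t.
Proof.
move=> w0 fc fw.
have A0 : `[0, w] !=set0 by exists 0; rewrite /= in_itv/= lexx ltW.
have [h1 _ [c _ h2]] := compact_image_bounds A0 (@segment_compact _ 0 w)
  (continuous_subspaceT fc).
split=> [t|]; last by exists c.
have [n /andP[n0 nw]] := period_reduce t w0.
by rewrite -(periodicz fw n t); apply: h1; rewrite /= in_itv/= n0 ltW.
Qed.

(* The mean value theorem yields derivatives of modulus at most [C] at points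
   arbitrarily close to [t] on the right. *)
Lemma derive_bound_right (y v : K -> K) (t b C : K) : t < b ->
  (forall s : K, is_derive s 1 y (v s)) -> {for t, continuous v} ->
  (forall s, t <= s < b -> `|y s - y t| <= C * (s - t)) -> `|v t| <= C.
Proof.
move=> tb yd vc yL; rewrite leNgt; apply/negP => Ct.
have : nbhs t (fun s => C < `|v s|) by exact: (cvgr_norm_gt (v t) vc C Ct).
move=> [e /= e0 He].
pose s := t + Num.min e (b - t) / 2.
have [se sb] : s - t < e /\ s < b.
  by rewrite /s; case: (ltP e (b - t)) => h; split; lra.
have ts : t < s by rewrite /s ltrDl divr_gt0// lt_min e0 subr_gt0.
have [c /[!in_itv]/= /andP[tc cs] E] := MVT ts (fun x _ => yd x)
  (continuous_subspaceT (fun x => is_derive_cont (yd x))).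
have := yL s; rewrite (ltW ts) sb E normrM (gtr0_norm (_ : 0 < s - t)) ?subr_gt0//.
move=> /(_ isT); rewrite ler_pM2r ?subr_gt0//; apply/negP; rewrite -ltNge.
apply: He; rewrite /= ltr0_norm; lra.
Qed.

Lemma periodic_solution_of_derive (w : K) (p q h y v g : K -> K) : periodic y w ->
  (forall t : K, is_derive t 1 y (v t)) -> (forall t : K, is_derive t 1 v (g t)) ->
  (forall t, g t + p t * v t + q t * y t = h t) -> periodic_solution w p q h y.
Proof.
move=> yw yd vd E.
have vE : derive1 y = v.
  by apply/funext => t; rewrite derive1E; have [_ ->] := yd t.
split=> // t.
- by rewrite vE; have [] := vd t.
- by rewrite vE derive1E; have [_ ->] := vd t; exact: E.
Qed.

End Extrema.

Section Green.
Context {K : realType}.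
Variables (w : K) (p q : K -> K) (G : K -> K -> K).
Hypotheses (w0 : 0 < w) (Gg : is_periodic_green w p q G)
  (G0 : forall t s, 0 <= t <= w -> 0 <= s <= w -> 0 < G t s).

Let Q := `[0, w] `*` `[0, w].
Let Gc : {within Q, continuous (fun z : K * K => G z.1 z.2)}.
Proof. by case: Gg. Qed.
Let Qn0 : Q !=set0.
Proof. by exists (0, 0); rewrite /Q /= !in_itv/= lexx ltW. Qed.
Let Qcompact : compact Q.
Proof. by apply: compact_setX; exact: segment_compact. Qed.

Lemma green_range t s : 0 <= t <= w -> 0 <= s <= w ->
  green_min w G <= G t s <= green_max w G.
Proof.
move=> tw sw; have [h1 h2 _] := compact_image_bounds Qn0 Qcompact Gc.
have Qts : Q (t, s) by rewrite /Q /= !in_itv.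
by rewrite (h1 (t, s))// (h2 (t, s)).
Qed.

Lemma green_min_gt0 : 0 < green_min w G.
Proof.
have [_ _ [c]] := compact_image_bounds Qn0 Qcompact Gc.
rewrite /Q /= !in_itv/= => -[c1 c2] E.
by rewrite /green_min [X in 0 < X]E; exact: G0.
Qed.

Lemma triangle_bounded (D : K * K -> K) (T : set (K * K)) :
  closed T -> T `<=` Q -> {within T, continuous D} ->
  exists B, forall z, T z -> `|D z| <= B.
Proof.
move=> cT TQ cD.
have Tc : compact T by exact: subclosed_compact cT Qcompact TQ.
have [T0|T0] := pselect (T !=set0); last first.
  by exists 0 => z Tz; exfalso; apply: T0; exists z.
have cN : {within T, continuous (fun z => `|D z|)}.
  by move=> z; apply: cvg_norm; exact: cD.
have [C _ HC] := compact_EVT_max T0 Tc cN.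
by exists `|D C| => z Tz; apply: HC; rewrite inE.
Qed.

Lemma closed_le_fun (T : topologicalType) (f g : T -> K) :
  continuous f -> continuous g -> closed [set z | f z <= g z].
Proof.
move=> fc gc.
have -> : [set z | f z <= g z] = (fun z => g z - f z) @^-1` [set x | 0 <= x].
  by apply/seteqP; split=> z /=; rewrite subr_ge0.
apply: preimage_closed; last exact: closed_ge.
by move=> z _; apply: cvgB; [exact: gc|exact: fc].
Qed.

(** [sup] is an upper bound only for a set that is bounded above. Boundedness comes from [D1] and
    [D2], which are continuous on compact triangles. *)
Lemma green_dmax_spec :
  0 <= green_dmax w G /\
  forall t s, 0 < t < w -> 0 <= s <= w -> t != s ->
    derivable (fun t' => G t' s) t 1 /\
    `|derive1 (fun t' => G t' s) t| <= green_dmax w G.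
Proof.
have [_ [D1 [D2 [D1c D2c G1 G2]]] _] := Gg.
have f1 : continuous (@fst K K) by move=> z; exact: cvg_fst.
have f2 : continuous (@snd K K) by move=> z; exact: cvg_snd.
have c0 (c : K) : continuous (fun _ : K * K => c) by move=> z; exact: cvg_cst.
have [B1 HB1] : exists B, forall z : K * K,
    0 <= z.1 /\ z.1 <= z.2 /\ z.2 <= w -> `|D1 z| <= B.
  apply: (triangle_bounded _ _ D1c).
    apply: closedI; first exact: closed_le_fun (c0 0) f1.
    by apply: closedI; [exact: closed_le_fun f1 f2|exact: closed_le_fun f2 (c0 w)].
  move=> [a b] /= [h1 [h2 h3]]; rewrite /Q /= !in_itv/= h1 h3.
  by rewrite (le_trans h2 h3) (le_trans h1 h2).
have [B2 HB2] : exists B, forall z : K * K,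
    0 <= z.2 /\ z.2 <= z.1 /\ z.1 <= w -> `|D2 z| <= B.
  apply: (triangle_bounded _ _ D2c).
    apply: closedI; first exact: closed_le_fun (c0 0) f2.
    by apply: closedI; [exact: closed_le_fun f2 f1|exact: closed_le_fun f1 (c0 w)].
  move=> [a b] /= [h1 [h2 h3]]; rewrite /Q /= !in_itv/= h1 h3.
  by rewrite (le_trans h2 h3) (le_trans h1 h2).
have dG t s : 0 < t < w -> 0 <= s <= w -> t != s ->
    derivable (fun t' => G t' s) t 1 /\
    `|derive1 (fun t' => G t' s) t| <= Num.max B1 B2.
  move=> /andP[t0 tw] /andP[s0 sw] ts.
  have [ts'|st] := ltP t s.
    have [dd dE] := G1 t s t0 ts' sw; split=> //.
    rewrite derive1E dE le_max; apply/orP; left; apply: HB1 => /=.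
    by split; [exact: ltW|split => //; exact: ltW].
  have st' : s < t by rewrite lt_neqAle eq_sym ts.
  have [dd dE] := G2 t s s0 st' tw; split=> //.
  rewrite derive1E dE le_max; apply/orP; right; apply: HB2 => /=.
  by split=> //; split; exact: ltW.
pose A : set (K * K) := [set z : K * K | 0 < z.1 < w /\ 0 <= z.2 <= w /\ z.1 != z.2].
pose S := [set `|derive1 (fun t => G t z.2) z.1| | z in A].
have Sub : has_ubound S.
  by exists (Num.max B1 B2) => _ [[t s] [/= h1 [h2 h3]] <-]; exact: (dG _ _ h1 h2 h3).2.
have SA t s : 0 < t < w -> 0 <= s <= w -> t != s ->
    `|derive1 (fun t' => G t' s) t| <= green_dmax w G.
  by move=> h1 h2 h3; apply: (ub_le_sup Sub); exists (t, s).
split; last by move=> t s h1 h2 h3; split; [exact: (dG _ _ h1 h2 h3).1|exact: SA].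
(* Any off-diagonal sample point shows that the supremum is nonnegative. *)
apply: le_trans (SA (w / 2) 0 _ _ _) => //.
- by apply/andP; split; [rewrite divr_gt0|rewrite ltr_pdivrMr// ltr_pMr// ltr1n].
- by rewrite lexx ltW.
- by rewrite gt_eqF// divr_gt0.
Qed.

Let D := green_dmax w G.

Lemma green_section_continuous s : 0 <= s <= w ->
  {within `[0, w], continuous (fun t => G t s)} /\
  {within `[0, w], continuous (G s)}.
Proof.
move=> sw; move/subspace_continuousP: Gc => Gc'.
have key (j : K -> K * K) : continuous j -> (forall t, 0 <= t <= w -> Q (j t)) ->
    {within `[0, w], continuous (fun t => G (j t).1 (j t).2)}.
  move=> jc jQ; apply/subspace_continuousP => t; rewrite /= in_itv/= => tw P HP.
  have := Gc' _ (jQ t tw) P HP; rewrite /nbhs/= /within/= => H.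
  apply: (filterS (F := nbhs t) _ (jc t _ H)) => x /= Hx; rewrite in_itv/= => xw.
  exact/Hx/jQ.
split.
- apply: (key (fun t => (t, s))) => [t|t tw]; last by rewrite /Q /= !in_itv.
  exact: (@cvg_pair _ _ _ (nbhs t) (nbhs t) (nbhs s) _ _ _ id (fun=> s) (@cvg_id _ _) (cvg_cst s)).
- apply: (key (fun t => (s, t))) => [t|t tw]; last by rewrite /Q /= !in_itv.
  exact: (@cvg_pair _ _ _ (nbhs t) (nbhs s) (nbhs t) _ _ _ (fun=> s) id (cvg_cst s) (@cvg_id _ _)).
Qed.

(** The derivative in [t] may jump at [t = s], so the mean value theorem is used on each side of the
    diagonal, and an interval that crosses it is split at [s]. *)
Lemma green_lipschitz s t t' : 0 <= s <= w -> 0 <= t -> t <= t' -> t' <= w ->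
  `|G t' s - G t s| <= D * (t' - t).
Proof.
move=> sw t0 tt' tw.
have [_ dG] := green_dmax_spec.
have [gc _] := green_section_continuous sw.
have aux a b : 0 <= a -> a <= b -> b <= w -> (b <= s) || (s <= a) ->
    `|G b s - G a s| <= D * (b - a).
  move=> a0 ab bw sab.
  have [->|anb] := eqVneq a b; first by rewrite !subrr normr0 mulr0.
  have {}ab : a < b by rewrite lt_neqAle anb.
  have dG' c : c \in `]a, b[%R -> derivable (fun t' => G t' s) c 1 /\
      `|derive1 (fun t' => G t' s) c| <= D.
    rewrite in_itv/= => /andP[ac cb]; apply: dG => //.
      by rewrite (le_lt_trans a0 ac) (lt_le_trans cb bw).
    by case/orP: sab => h; [rewrite lt_eqF// (lt_le_trans cb h)|
      rewrite gt_eqF// (le_lt_trans h ac)].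
  have gab : {within `[a, b], continuous (fun t' => G t' s)}.
    apply: continuous_subspaceW gc => x /=; rewrite !in_itv/= => /andP[h1 h2].
    by rewrite (le_trans a0 h1) (le_trans h2 bw).
  have gd c : c \in `]a, b[%R ->
      is_derive c 1 (fun t' => G t' s) (derive1 (fun t' => G t' s) c).
    by move=> /dG'[h _]; rewrite derive1E; exact: DeriveDef.
  have [c /dG'[_ cD] ->] := MVT ab gd gab.
  by rewrite normrM (gtr0_norm (_ : 0 < b - a)) ?subr_gt0// ler_wpM2r// subr_ge0 ltW.
have [t's|st'] := leP t' s; first by apply: aux => //; rewrite t's.
have [st|ts] := leP s t; first by apply: aux => //; rewrite st orbT.
have -> : G t' s - G t s = (G t' s - G s s) + (G s s - G t s) by ring.
apply: (le_trans (ler_normD _ _)).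
have -> : D * (t' - t) = D * (t' - s) + D * (s - t) by ring.
case/andP: sw => s0 sw.
by apply: lerD; apply: aux; rewrite ?lexx ?orbT//; exact: ltW.
Qed.

(** [H] is the integral of [h] over a period. The bound on [v] avoids differentiating under the
    integral across the kink: the Lipschitz bound on [G] controls increments of [y], hence its
    derivative. *)
Lemma green_solution_bounds (h y v g : K -> K) :
  continuous h -> periodic h w -> (forall t, 0 < h t) -> periodic y w ->
  (forall t : K, is_derive t 1 y (v t)) -> (forall t : K, is_derive t 1 v (g t)) ->
  (forall t, g t + p t * v t + q t * y t = h t) ->
  exists H, [/\ forall m, (forall t, m <= h t) -> m * w <= H,
    forall m, (forall t, h t <= m) -> H <= m * w,
    forall t, green_min w G * H <= y t <= green_max w G * H &
    forall t, `|v t| <= D * H].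
Proof.
move=> hc hw h0 yw yd vd yE.
pose mu := @lebesgue_measure K.
have hi : mu.-integrable `[0, w] (EFin \o h).
  apply: continuous_compact_integrable; first exact: segment_compact.
  exact: continuous_subspaceT.
have ki (k : K -> K) : {within `[0, w], continuous k} ->
    mu.-integrable `[0, w] (EFin \o (fun s => k s * h s)).
  move=> kc; apply: continuous_compact_integrable; first exact: segment_compact.
  by move=> x; apply: cvgM; [exact: kc|exact: (continuous_subspaceT hc)].
have mI : measurable `[0, w] by [].
have muw : fine (mu `[0, w]) = w.
  by rewrite /mu lebesgue_measure_itv/= lte_fin w0 -EFinD/= subr0.
have ci (c : K) : mu.-integrable `[0, w] (EFin \o (fun=> c)).
  apply: continuous_compact_integrable; first exact: segment_compact.
  by apply: continuous_subspaceT => x; exact: cvg_cst.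
have kci (c : K) : mu.-integrable `[0, w] (EFin \o (fun s => c * h s)).
  by apply: ki; apply: continuous_subspaceT => x; exact: cvg_cst.
pose H := \int[mu]_(s in `[0, w]) h s.
have D0 : 0 <= D by case: green_dmax_spec.
have yint t : 0 <= t <= w -> y t = \int[mu]_(s in `[0, w]) (G t s * h s).
  have [_ _ /(_ h hc hw h0)[u [_ uU uE]]] := Gg.
  suff -> : y = u by exact: uE.
  exact/uU/(periodic_solution_of_derive yw yd vd).
have vper := periodic_derive yw yd.
exists H; split.
- move=> m mh; rewrite -[X in _ * X]muw -Rintegral_cst//.
  by apply: le_Rintegral => // s _; exact: mh.
- move=> m mh; rewrite -[X in _ * X]muw -Rintegral_cst//.
  by apply: le_Rintegral => // s _; exact: mh.
- move=> t; have [n /andP[n0 nw]] := period_reduce t w0.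
  rewrite -(periodicz yw n t); set r := t + _ in n0 nw *.
  have rw : 0 <= r <= w by rewrite n0 ltW.
  have [_ Gr] := green_section_continuous rw.
  have Gb x : 0 <= x <= w -> green_min w G * h x <= G r x * h x <= green_max w G * h x.
    by move=> xw; have /andP[? ?] := green_range rw xw; rewrite !ler_pM2r//; apply/andP.
  rewrite yint// /H -!RintegralZl//; apply/andP; split; apply: le_Rintegral;
    [exact: mI|exact: kci|exact: ki| |exact: mI|exact: ki|exact: kci|] => x;
    by rewrite /= in_itv/= => /Gb/andP[].
- move=> t; have [n /andP[n0 nw]] := period_reduce t w0.
  rewrite -(periodicz vper n t); set r := t + _ in n0 nw *.
  have rw : 0 <= r <= w by rewrite n0 ltW.
  (* The reduced point satisfies [r < w], so points to its right remain in the interval where the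
     integral formula holds. *)
  apply: (derive_bound_right nw yd); first exact: is_derive_cont (vd r).
  move=> s /andP[rs sw]; have sw' : 0 <= s <= w by rewrite (le_trans n0 rs) ltW.
  have [_ Gr] := green_section_continuous rw.
  have [_ Gs] := green_section_continuous sw'.
  rewrite !yint// -RintegralB//; [|exact: ki|exact: ki].
  have di : mu.-integrable `[0, w] (EFin \o (fun x => (G s x - G r x) * h x)).
    by apply: ki => x; apply: cvgB; [exact: Gs|exact: Gr].
  under eq_Rintegral do rewrite -mulrBl.
  apply: (le_trans (le_normr_Rintegral _ di)) => //.
  rewrite mulrAC /H -RintegralZl//; apply: le_Rintegral => //.
  + apply: continuous_compact_integrable; first exact: segment_compact.
    move=> x; apply: cvg_norm; apply: cvgM; last exact: (continuous_subspaceT hc).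
    by apply: cvgB; [exact: Gs|exact: Gr].
  + move=> x /=; rewrite in_itv/= => xw; rewrite normrM (gtr0_norm (h0 x)).
    by rewrite ler_pM2r//; apply: green_lipschitz => //; exact: ltW.
Qed.

End Green.

(** * The truncated nonlinearity *)

Section Powers.
Context {K : realType}.

(** For a ≤ 1 the derivative a z^(a-1) is nonincreasing, so on [m, ∞) it is at most its value at
    [m]. *)
Lemma powR_lipschitz (m a x y : K) : 0 < m -> 0 <= a <= 1 -> m <= x -> m <= y ->
  `|x `^ a - y `^ a| <= a * m `^ (a - 1) * `|x - y|.
Proof.
move=> m0 /andP[a0 a1].
have C0 : 0 <= a * m `^ (a - 1) by rewrite mulr_ge0// powR_ge0.
wlog xy : x y / x <= y.
  move=> H mx my; have [xy|/ltW yx] := leP x y; first exact: H.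
  by rewrite distrC [X in _ * X]distrC; exact: H.
move=> mx my; have [->|xny] := eqVneq x y; first by rewrite !subrr normr0 mulr0.
have {}xy : x < y by rewrite lt_neqAle xny.
have pd (z : K) : 0 < z -> is_derive z 1 (fun u : K => u `^ a) (a * z `^ (a - 1)).
  exact: is_derive1_powR.
have [||c /[!in_itv]/= /andP[xc cy] E] := @MVT K (fun u => u `^ a) (fun z => a * z `^ (a - 1)) x y xy.
- by move=> z; rewrite in_itv/= => /andP[xz _]; apply: pd; lra.
- apply: derivable_within_continuous => z; rewrite in_itv/= => /andP[xz _].
  have z0 : 0 < z by lra.
  by have [] := pd z z0.
rewrite distrC E normrM distrC ler_wpM2r//.
rewrite ger0_norm ?mulr_ge0 ?powR_ge0// ler_wpM2l//.
have -> : a - 1 = - (1 - a) by ring.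
rewrite !powRN lef_pV2 ?posrE ?powR_gt0//; try lra.
by rewrite ge0_ler_powR ?nnegrE; lra.
Qed.

Lemma powR_sublinear (a A eta : K) : 0 < a -> a < 1 -> 0 <= A -> 0 < eta ->
  exists R1, forall R, R1 <= R -> A * R `^ a <= eta * R.
Proof.
(* The claim amounts to A/eta ≤ R^(1-a), whose threshold is [S]. *)
move=> a0 a1 A0 eta0; pose S := (A / eta) `^ (1 - a)^-1.
exists (Num.max 1 S) => R; rewrite ge_max => /andP[R1 SR].
have R0 : 0 < R by lra.
have a1' : 0 < 1 - a by lra.
have RE : R = R `^ (1 - a) * R `^ a.
  rewrite -powRD; last by rewrite lt0r_neq0 ?implybT.
  by rewrite subrK powRr1// ltW.
rewrite [X in _ <= _ * X]RE mulrA ler_wpM2r ?powR_ge0//.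
rewrite mulrC -ler_pdivrMr//.
have -> : A / eta = S `^ (1 - a).
  by rewrite /S -powRrM mulVf ?lt0r_neq0// powRr1// divr_ge0// ltW.
by rewrite ge0_ler_powR ?nnegrE ?powR_ge0//; lra.
Qed.

End Powers.

Section Truncation.
Context {K : realType}.
Variables (m R0 de : K).
Hypotheses (m0 : 0 < m) (mR : m <= R0) (de0 : 0 <= de).

Definition clip (y : K) := Num.max m (Num.min y R0).
Definition trunc_quot (y v : K) := Num.min `|v| (de * clip y) ^+ 2 / clip y.

Lemma clip_bounds y : m <= clip y <= R0.
Proof. by rewrite /clip le_max lexx/= ge_max mR ge_min lexx orbT. Qed.

Lemma clip_id y : m <= y -> y <= R0 -> clip y = y.
Proof. by move=> my yR; rewrite /clip min_l// max_r. Qed.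

Lemma clip_lipschitz x y : `|clip x - clip y| <= `|x - y|.
Proof.
wlog xy : x y / x <= y.
  move=> H; have [xy|/ltW yx] := leP x y; first exact: H.
  by rewrite distrC [leRHS]distrC; exact: H.
rewrite distrC [leRHS]distrC [leRHS]ger0_norm ?subr_ge0// /clip.
have : 0 <= Num.min y R0 - Num.min x R0 <= y - x.
  by case: (leP x R0) => ?; case: (leP y R0) => ?; apply/andP; split; lra.
move: (Num.min y R0) (Num.min x R0) => b a /andP[ab bx].
by rewrite ler_norml; case: (leP m a) => ?; case: (leP m b) => ?; apply/andP; split; lra.
Qed.

Lemma clip_powR_lipschitz a x y : 0 <= a <= 1 ->
  `|clip x `^ a - clip y `^ a| <= a * m `^ (a - 1) * `|x - y|.
Proof.
move=> a01; have /andP[mx _] := clip_bounds x; have /andP[my _] := clip_bounds y.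
apply: (le_trans (powR_lipschitz m0 a01 mx my)).
rewrite ler_wpM2l ?clip_lipschitz// mulr_ge0 ?powR_ge0//; by case/andP: a01.
Qed.

Lemma clip_gt0 y : 0 < clip y.
Proof. by have /andP[my _] := clip_bounds y; exact: lt_le_trans my. Qed.

Lemma trunc_quot_bounds y v : 0 <= trunc_quot y v <= de ^+ 2 * R0.
Proof.
rewrite /trunc_quot; have Y0 := clip_gt0 y; have /andP[_ YR] := clip_bounds y.
set Y := clip y in Y0 YR *; set W := Num.min _ _.
have W0 : 0 <= W by rewrite /W le_min normr_ge0 mulr_ge0// ltW.
have WY : W <= de * Y by rewrite /W ge_min lexx orbT.
rewrite divr_ge0 ?sqr_ge0 ?(ltW Y0)//= ler_pdivrMr//.
apply: (@le_trans _ _ ((de * Y) ^+ 2)).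
  by rewrite ler_sqr ?nnegrE// mulr_ge0// ltW.
have -> : (de * Y) ^+ 2 = de ^+ 2 * Y * Y by ring.
by rewrite ler_wpM2r ?(ltW Y0)// ler_wpM2l// sqr_ge0.
Qed.

Lemma trunc_quot_id y v : m <= y -> y <= R0 -> `|v| <= de * y ->
  trunc_quot y v = `|v| ^+ 2 / y.
Proof. by move=> my yR vy; rewrite /trunc_quot clip_id// min_l. Qed.

Lemma trunc_quot_lipschitz y v y' v' :
  `|trunc_quot y v - trunc_quot y' v'| <=
     (2 * de + 3 * de ^+ 2) * (`|y - y'| + `|v - v'|).
Proof.
rewrite /trunc_quot; have Y0 := clip_gt0 y; have Y0' := clip_gt0 y'.
have YY := clip_lipschitz y y'.
set Y := clip y in Y0 YY *; set Y' := clip y' in Y0' YY *.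
set W := Num.min `|v| _; set W' := Num.min `|v'| _.
have WY : 0 <= W <= de * Y.
  by rewrite /W le_min normr_ge0 mulr_ge0 ?(ltW Y0)//= ge_min lexx orbT.
have WY' : 0 <= W' <= de * Y'.
  by rewrite /W' le_min normr_ge0 mulr_ge0 ?(ltW Y0')//= ge_min lexx orbT.
have WW : `|W - W'| <= `|v - v'| + de * `|Y - Y'|.
  have h1 : `| `|v| - `|v'| | <= `|v - v'| by exact: ler_dist_dist.
  have h2 : `|de * Y - de * Y'| = de * `|Y - Y'| by rewrite -mulrBr normrM ger0_norm.
  have h3 := normr_ge0 (v - v').
  have h4 : 0 <= de * `|Y - Y'| by rewrite mulr_ge0.
  move: h1; have : `|de * Y - de * Y'| <= de * `|Y - Y'| by rewrite h2.
  rewrite /W /W' !ler_norml => /andP[? ?] /andP[? ?].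
  case: (leP `|v| _) => ?; case: (leP `|v'| _) => ?; apply/andP; split; lra.
have e1 : `|W / Y| <= de.
  case/andP: WY => h1 h2.
  by rewrite ger0_norm ?divr_ge0// ?(ltW Y0)// ler_pdivrMr.
have e1' : `|W' / Y'| <= de.
  case/andP: WY' => h1 h2.
  by rewrite ger0_norm ?divr_ge0// ?(ltW Y0')// ler_pdivrMr.
(* This splitting involves only the ratios W/Y and W'/Y', both at most [de], so no inverse power of
   [m] enters the Lipschitz constant. *)
have -> : W ^+ 2 / Y - W' ^+ 2 / Y' =
  (W - W') * (W / Y) + (W' / Y') * ((W - W') + (W / Y) * (Y' - Y)).
  by field; rewrite !lt0r_neq0.
have d1 : `|(W - W') * (W / Y)| <= `|W - W'| * de.
  by rewrite normrM ler_wpM2l.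
have d2 : `|(W' / Y') * ((W - W') + (W / Y) * (Y' - Y))| <=
    de * (`|W - W'| + de * `|Y - Y'|).
  rewrite normrM ler_pM//; apply: (le_trans (ler_normD _ _)).
  by rewrite lerD2l normrM (distrC Y' Y) ler_wpM2r.
apply: (le_trans (ler_normD _ _)); apply: (le_trans (lerD d1 d2)).
have -> : `|W - W'| * de + de * (`|W - W'| + de * `|Y - Y'|) =
  2 * de * `|W - W'| + de ^+ 2 * `|Y - Y'| by ring.
have k1 : 2 * de * `|W - W'| <= 2 * de * (`|v - v'| + de * `|Y - Y'|).
  by rewrite ler_wpM2l// mulr_ge0.
have k2 : de ^+ 2 * `|Y - Y'| <= de ^+ 2 * `|y - y'| by rewrite ler_wpM2l// sqr_ge0.
have k3 : 0 <= de * `|y - y'| by rewrite mulr_ge0.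
have k4 : 0 <= de ^+ 2 * `|v - v'| by rewrite mulr_ge0// sqr_ge0.
by lra.
Qed.

End Truncation.

(** * The homogeneous problem and the substitution x = y^α *)

Section Solutions.
Context {K : realType}.

(** Adding a homogeneous solution to the solution for the right-hand side 1 gives another one, and
    the Green property makes that solution unique. *)
Lemma green_homogeneous (w : K) (p q : K -> K) (G : K -> K -> K) :
  is_periodic_green w p q G ->
  forall y v, flow (lin_field p q) y v -> periodic y w -> forall t, y t = 0.
Proof.
move=> [_ _ HG] y v [yd vd] yw t.
have [u [[uw ud udd uE] uU _]] := HG (fun=> 1) (fun=> cvg_cst _) (fun=> erefl) (fun=> ltr01).
suff : u + y = u by move=> /(congr1 (fun k => k t)); rewrite !fctE; lra.
apply: uU.
have du (s : K) : is_derive s 1 u (derive1 u s).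
  by rewrite derive1E; exact: derivableP.
have ddu (s : K) : is_derive s 1 (derive1 u) (derive1 (derive1 u) s).
  by rewrite (derive1E (derive1 u)); exact: derivableP.
apply: (@periodic_solution_of_derive _ w p q (fun=> 1) (u + y) (derive1 u + v)
  (fun s => derive1 (derive1 u) s + lin_field p q s (y s) (v s))).
- by move=> s; rewrite !fctE uw yw.
- by move=> s; rewrite !fctE /lin_field -(uE s); ring.
Qed.

Lemma powR_comp_derive (y v : K -> K) (a : K) (t : K) : 0 < y t ->
  is_derive t 1 y (v t) ->
  is_derive t 1 (fun s => y s `^ a) (a * y t `^ (a - 1) * v t).
Proof.
by move=> y0 yd; exact: (is_derive1_comp (is_derive1_powR a y0) yd).
Qed.

(** In x'' = α((α-1) y^(α-2) y'² + y^(α-1) y''), the term (1-α) y'²/y of the equation for y cancels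
    the first summand. The b-term comes out as b y^(α-1), which is b/x^ρ1 because αρ1 = 1-α. *)
Lemma powR_solution (w al rho1 rho2 : K) (p q b c e y v g : K -> K) :
  0 < al -> al * (rho1 + 1) = 1 -> (forall t, 0 < y t) -> periodic y w ->
  (forall t : K, is_derive t 1 y (v t)) -> (forall t : K, is_derive t 1 v (g t)) ->
  (forall t, g t + p t * v t + q t / al * y t =
     c t / al * y t `^ (1 - al - al * rho2) + e t / al * y t `^ (1 - al)
     + (1 - al) * (`|v t| ^+ 2 / y t) + b t / al) ->
  periodic_solution w p q
    (fun t => b t / (y t `^ al) `^ rho1 + c t / (y t `^ al) `^ rho2 + e t)
    (fun t => y t `^ al).
Proof.
move=> al0 alE y0 yw yd vd yE.
apply: (@periodic_solution_of_derive _ _ _ _ _ _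
  (fun t => al * y t `^ (al - 1) * v t)
  (fun t => al * ((al - 1) * y t `^ (al - 1 - 1) * v t * v t + y t `^ (al - 1) * g t))).
- by move=> t; rewrite yw.
- by move=> t; exact: powR_comp_derive.
- move=> t; have h1 := powR_comp_derive (al - 1) (y0 t) (yd t); have h2 := vd t.
  have h3 := @is_deriveZ _ _ _ _ al _ _ _ (is_deriveM h1 h2).
  have -> : (fun t => al * y t `^ (al - 1) * v t) = al \*: ((fun s => y s `^ (al - 1)) * v).
    by apply/funext => s; rewrite -mulrA.
  by apply: (is_derive_eq h3); rewrite /GRing.scale/=; ring.
- move=> t; have yt := y0 t; have yn : y t != 0 by rewrite lt0r_neq0.
  have gE : g t = c t / al * y t `^ (1 - al - al * rho2) + e t / al * y t `^ (1 - al)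
     + (1 - al) * (`|v t| ^+ 2 / y t) + b t / al - p t * v t - q t / al * y t.
    by rewrite -yE; ring.
  rewrite gE real_normK ?num_real// -!powRrM.
  have -> : al * rho1 = 1 - al by lra.
  have -> : y t `^ (1 - al - al * rho2) = y t `^ (1 - al) / y t `^ (al * rho2).
    by rewrite powRB// yn implybT.
  have -> : y t `^ (al - 1 - 1) = y t `^ (al - 1) / y t.
    by rewrite [LHS]powRB ?yn ?implybT// powRr1// ltW.
  have -> : y t `^ al = y t `^ (al - 1) * y t.
    by rewrite -{3}(powRr1 (ltW yt)) -powRD ?yn ?implybT// subrK.
  have -> : y t `^ (al - 1) = (y t `^ (1 - al))^-1.
    by rewrite -powRN opprB.
  have P0 : y t `^ (1 - al) != 0 by rewrite lt0r_neq0// powR_gt0.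
  have Z0 : y t `^ (al * rho2) != 0 by rewrite lt0r_neq0// powR_gt0.
  have aln : al != 0 by rewrite lt0r_neq0.
  by field; rewrite aln P0 Z0 yn.
Qed.

End Solutions.

(** * A priori bounds and removal of the truncation *)

Section BoundedSolution.
Context {K : realType}.

(** For [R] large, each of the two powers and the constant takes at most a third of the slack
    (1-k)R. *)
Lemma sublinear_level (m k A1 A2 A3 a1 a2 : K) : 0 < a1 < 1 -> 0 < a2 < 1 ->
  0 <= A1 -> 0 <= A2 -> k < 1 ->
  exists R, m <= R /\ A1 * R `^ a1 + A2 * R `^ a2 + k * R + A3 <= R.
Proof.
move=> /andP[a10 a11] /andP[a20 a21] A10 A20 k1.
have eta0 : 0 < (1 - k) / 3 by rewrite divr_gt0//; lra.
have [R1 H1] := powR_sublinear a10 a11 A10 eta0.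
have [R2 H2] := powR_sublinear a20 a21 A20 eta0.
pose R := Num.max (Num.max R1 R2) (Num.max m (A3 / ((1 - k) / 3))).
have R1R : R1 <= R by rewrite !le_max lexx.
have R2R : R2 <= R by rewrite !le_max lexx orbT.
have mR : m <= R by rewrite !le_max lexx !orbT.
have : A3 / ((1 - k) / 3) <= R by rewrite !le_max lexx !orbT.
rewrite ler_pdivrMr// => A3R.
exists R; split=> //; have := H1 R R1R; have := H2 R R2R; lra.
Qed.

(** In the application the coefficients are already divided by α, [be] = 1-α-αρ2, and [mu] = [k] =
    1-α. [low] and [high] say that the interval [m, R0] reproduces itself through the Green
    estimates. *)
Variables (w : K) (p q c e b : K -> K) (G : K -> K -> K).
Variables (be mu k m R0 de cm Bc Be Bb : K).
Hypotheses (w0 : 0 < w) (pc : continuous p) (pw : periodic p w)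
  (qc : continuous q) (qw : periodic q w)
  (cc : continuous c) (cw : periodic c w)
  (ec : continuous e) (ew : periodic e w)
  (bc : continuous b) (bw : periodic b w)
  (Gg : is_periodic_green w p q G)
  (G0 : forall t s, 0 <= t <= w -> 0 <= s <= w -> 0 < G t s)
  (be01 : 0 <= be <= 1) (mu01 : 0 <= mu <= 1) (k0 : 0 <= k) (m0 : 0 < m) (mR : m <= R0)
  (de0 : 0 <= de) (dG : green_dmax w G <= de * green_min w G)
  (cm0 : 0 < cm) (cmc : forall t, cm <= c t)
  (cB : forall t, `|c t| <= Bc) (eB : forall t, `|e t| <= Be) (bB : forall t, `|b t| <= Bb)
  (e0 : forall t, 0 <= e t) (eb0 : forall t, 0 <= e t * m `^ mu + b t)
  (low : m <= green_min w G * (cm * m `^ be * w))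
  (high : green_max w G *
    ((Bc * R0 `^ be + Be * R0 `^ mu + k * (de ^+ 2 * R0) + Bb) * w) <= R0).

Let N t y v := c t * clip m R0 y `^ be + e t * clip m R0 y `^ mu
  + k * trunc_quot m R0 de y v + b t.

Let Hmax := Bc * R0 `^ be + Be * R0 `^ mu + k * (de ^+ 2 * R0) + Bb.

(** The lower bound comes from the c-term alone: clipping at [m] makes the e-term outweigh b, and
    the quotient is nonnegative. *)
Let N_bounds t y v : cm * m `^ be <= N t y v <= Hmax.
Proof.
have [m0' mR' cm0'] := And3 m0 mR cm0.
have /andP[mY YR] := clip_bounds mR y.
have /andP[W0 WR] := trunc_quot_bounds m0 mR de0 y v.
have be0 : 0 <= be by case/andP: be01.
have mu0 : 0 <= mu by case/andP: mu01.
have Y0 := clip_gt0 m0 mR y.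
have mono a : 0 <= a -> m `^ a <= clip m R0 y `^ a <= R0 `^ a.
  move=> a0; have R00 := lt_le_trans m0 mR; rewrite !ge0_ler_powR ?nnegrE // ?ltW//.
have /andP[b1 b2] := mono _ be0; have /andP[u1 u2] := mono _ mu0.
have p1 := powR_ge0 m be; have p2 := powR_ge0 m mu.
have ct := cmc t; have cb := ler_norm (c t); have cb' := cB t.
have et := e0 t; have eb := ler_norm (e t); have eb' := eB t.
have bb := ler_norm (b t); have bb' := bB t; have ebt := eb0 t.
have kW0 : 0 <= k * trunc_quot m R0 de y v by rewrite mulr_ge0.
have kW1 : k * trunc_quot m R0 de y v <= k * (de ^+ 2 * R0) by rewrite ler_wpM2l.
apply/andP; split.
- have h1 : cm * m `^ be <= c t * clip m R0 y `^ be by rewrite ler_pM// ltW.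
  have h2 : e t * m `^ mu <= e t * clip m R0 y `^ mu by rewrite ler_wpM2l.
  by rewrite /N; lra.
- have h1 : c t * clip m R0 y `^ be <= Bc * R0 `^ be.
    by rewrite ler_pM ?powR_ge0//; lra.
  have h2 : e t * clip m R0 y `^ mu <= Be * R0 `^ mu.
    by rewrite ler_pM ?powR_ge0//; lra.
  by rewrite /N /Hmax; lra.
Qed.

Let N_comp_continuous (y v : K -> K) : continuous y -> continuous v ->
  continuous (fun t => N t (y t) (v t)).
Proof.
move=> yc vc.
have powc a : 0 <= a <= 1 -> continuous (fun t => clip m R0 (y t) `^ a).
  move=> a01; have C0 : 0 <= a * m `^ (a - 1).
    by rewrite mulr_ge0 ?powR_ge0//; case/andP: a01.
  apply: (@lipschitz2_comp_continuous _ _ (fun s _ => clip m R0 s `^ a) _ y v C0) => //.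
  move=> s1 s2 s3 s4; apply: (le_trans (clip_powR_lipschitz m0 mR _ _ a01)).
  by rewrite ler_wpM2l// lerDl.
have de00 : 0 <= 2 * de + 3 * de ^+ 2 by rewrite addr_ge0// mulr_ge0// sqr_ge0.
have qcc := lipschitz2_comp_continuous de00 (trunc_quot_lipschitz m0 mR de0) yc vc.
move=> t; apply: cvgD; last exact: bc.
apply: cvgD; last by apply: cvgM; [exact: cvg_cst|exact: qcc].
apply: cvgD; apply: cvgM; [exact: cc|exact: powc|exact: ec|exact: powc].
Qed.

Let N_lipschitz : exists L, 0 <= L /\ lipschitz2 L N.
Proof.
pose L1 := Bc * (be * m `^ (be - 1)); pose L2 := Be * (mu * m `^ (mu - 1)).
pose L3 := k * (2 * de + 3 * de ^+ 2).
have Bc0 : 0 <= Bc := le_trans (normr_ge0 _) (cB 0).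
have Be0 : 0 <= Be := le_trans (normr_ge0 _) (eB 0).
have P a : 0 <= a <= 1 -> 0 <= a * m `^ (a - 1).
  by move=> /andP[a0 _]; rewrite mulr_ge0// powR_ge0.
have L10 : 0 <= L1 by rewrite mulr_ge0// P.
have L20 : 0 <= L2 by rewrite mulr_ge0// P.
have de2 : 0 <= 2 * de + 3 * de ^+ 2 by rewrite addr_ge0// mulr_ge0// sqr_ge0.
have L30 : 0 <= L3 by rewrite mulr_ge0.
exists (L1 + L2 + L3); split; first by rewrite !addr_ge0.
move=> t y v y' v'.
have -> : N t y v - N t y' v' =
   c t * (clip m R0 y `^ be - clip m R0 y' `^ be)
   + e t * (clip m R0 y `^ mu - clip m R0 y' `^ mu)
   + k * (trunc_quot m R0 de y v - trunc_quot m R0 de y' v') by rewrite /N; ring.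
apply: (le_trans (ler_normD _ _)).
apply: (le_trans (lerD (ler_normD _ _) (lexx _))); rewrite !normrM (ger0_norm k0).
have h1 : `|c t| * `|clip m R0 y `^ be - clip m R0 y' `^ be| <= L1 * `|y - y'|.
  by rewrite -mulrA ler_pM//; exact: clip_powR_lipschitz.
have h2 : `|e t| * `|clip m R0 y `^ mu - clip m R0 y' `^ mu| <= L2 * `|y - y'|.
  by rewrite -mulrA ler_pM//; exact: clip_powR_lipschitz.
have h3 : k * `|trunc_quot m R0 de y v - trunc_quot m R0 de y' v'|
    <= L3 * (`|y - y'| + `|v - v'|).
  by rewrite -mulrA ler_wpM2l//; exact: trunc_quot_lipschitz.
have := mulr_ge0 L10 (normr_ge0 (v - v')); have := mulr_ge0 L20 (normr_ge0 (v - v')).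
by lra.
Qed.

(** The conclusion keeps the lower bound produced by the Green estimate rather than the weaker [m],
    because the final bound by r is drawn from it. *)
Theorem bounded_solution_exists : exists y v g : K -> K,
  [/\ periodic y w, forall t : K, is_derive t 1 y (v t),
      forall t : K, is_derive t 1 v (g t),
      forall t, g t + p t * v t + q t * y t =
        c t * y t `^ be + e t * y t `^ mu + k * (`|v t| ^+ 2 / y t) + b t &
      forall t, green_min w G * (cm * m `^ be * w) <= y t <= R0 /\ `|v t| <= de * y t].
Proof.
have [L [L0 NL]] := N_lipschitz.
have cmm0 : 0 < cm * m `^ be by rewrite mulr_gt0// powR_gt0.
have N0 t y v : 0 < N t y v by have /andP[h _] := N_bounds t y v; exact: lt_le_trans h.
have NM t y v : `|N t y v| <= Hmax.
  by rewrite gtr0_norm//; have /andP[] := N_bounds t y v.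
have M0 : 0 <= Hmax := le_trans (normr_ge0 _) (NM 0 0 0).
have Nw t y v : N (t + w) y v = N t y v by rewrite /N cw ew bw.
have [y [v [F yw]]] := periodic_flow_exists w0 pc pw qc qw (green_homogeneous Gg)
  L0 M0 NL NM Nw N_comp_continuous.
have [yd vd] := F.
pose h t := N t (y t) (v t).
have yc : continuous y by move=> t; exact: is_derive_cont (yd t).
have vc : continuous v by move=> t; exact: is_derive_cont (vd t).
have hc : continuous h by exact: N_comp_continuous.
have vw := periodic_derive yw yd.
have hw : periodic h w by move=> t; rewrite /h Nw yw vw.
have hE t : N t (y t) (v t) + lin_field p q t (y t) (v t) + p t * v t + q t * y t = h t.
  by rewrite /h /lin_field; ring.
have [H [H1 H2 Hy Hv]] := green_solution_bounds w0 Gg hc hw (fun t => N0 _ _ _) yw yd vd hE.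
have Gm0 := green_min_gt0 w0 Gg G0.
have HL : cm * m `^ be * w <= H by apply: H1 => t; have /andP[] := N_bounds t (y t) (v t).
have HU : H <= Hmax * w by apply: H2 => t; have /andP[] := N_bounds t (y t) (v t).
have wI : 0 <= (0 : K) <= w by rewrite lexx ltW.
have GM0 : 0 <= green_max w G.
  by have /andP[h1 h2] := green_range w0 Gg wI wI; lra.
have yb t : green_min w G * (cm * m `^ be * w) <= y t <= R0.
  have /andP[h1 h2] := Hy t; apply/andP; split.
    by apply: le_trans h1; rewrite ler_pM2l.
  by apply: (le_trans h2); apply: le_trans high; rewrite ler_wpM2l.
have ym t : m <= y t <= R0.
  by have /andP[h1 h2] := yb t; rewrite h2 (le_trans low h1).
(* With [H] the integral of the right-hand side, |v| ≤ [green_dmax] H ≤ de G_* H ≤ de y. *)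
have vb t : `|v t| <= de * y t.
  apply: (le_trans (Hv t)); have /andP[h1 _] := Hy t.
  have H0 : 0 <= H by apply: le_trans HL; rewrite ltW// mulr_gt0.
  apply: (@le_trans _ _ (de * green_min w G * H)); first by rewrite ler_wpM2r.
  by rewrite -mulrA ler_wpM2l.
exists y, v, (fun t => N t (y t) (v t) + lin_field p q t (y t) (v t)); split=> //.
move=> t; have /andP[h1 h2] := ym t.
by rewrite /N /lin_field clip_id// trunc_quot_id//; ring.
Qed.

End BoundedSolution.

(* When b_* > 0 the power of -b_*/e_* < 0 is meaningless; the nonlinearity is
   then positive without any lower bound on r, and [Num.max 0] makes the
   corresponding hypothesis vacuous. *)
Theorem theorem3p1 (K : realType) (omega : K) (p q b c e : K -> K)
    (rho1 rho2 alpha : K) (G : K -> K -> K) (sigma delta r : K)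
    (omega_gt0 : 0 < omega)
    (p_cont : continuous p) (p_per : periodic p omega)
    (q_cont : continuous q) (q_per : periodic q omega)
    (b_cont : continuous b) (b_per : periodic b omega)
    (c_cont : continuous c) (c_per : periodic c omega)
    (c_gt0 : forall t, 0 < c t)
    (e_cont : continuous e) (e_per : periodic e omega)
    (e_gt0 : forall t, 0 < e t)
    (rho1_gt0 : 0 < rho1) (rho2_gt0 : 0 < rho2) (rho_lt : rho2 < rho1)
    (alphaE : alpha = 1 / (rho1 + 1))
    (G_green : is_periodic_green omega p (fun t => q t / alpha) G)
    (G_gt0 : forall t s, 0 <= t <= omega -> 0 <= s <= omega -> 0 < G t s)
    (sigmaE : sigma = green_sigma omega G)
    (deltaE : delta = green_delta omega G)
    (r_gt0 : 0 < r)
    (r_ge : 1 / sigma *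
              (Num.max 0 (- (per_min omega b / per_min omega e)))
                `^ (1 / (1 - alpha)) <= r)
    (r_le : r <= (green_min omega G * per_min omega c * omega
                    * sigma `^ (1 - alpha - alpha * rho2) / alpha)
                   `^ (1 / (alpha + alpha * rho2)))
    (growth_lt1 : (1 - alpha) * (green_max omega G + delta * green_min omega G)
                    * delta ^+ 2 * omega / sigma < 1) :
  exists R : K, r < R /\
  exists y : K -> K,
    [/\ (forall t, 0 < y t),
        periodic_solution omega p (fun t => q t / alpha)
          (fun t => c t / alpha * y t `^ (1 - alpha - alpha * rho2)
                    + e t / alpha * y t `^ (1 - alpha)
                    + (1 - alpha) * (`|derive1 y t| ^+ 2 / y t)
                    + b t / alpha) y,
        r <= C1_norm omega y <= R &
        let x := fun t => y t `^ alpha in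
        (forall t, 0 < x t) /\
        periodic_solution omega p q
          (fun t => b t / x t `^ rho1 + c t / x t `^ rho2 + e t) x].
Proof.
have al0 : 0 < alpha by rewrite alphaE divr_gt0//; lra.
have alE : alpha * (rho1 + 1) = 1 by rewrite alphaE mul1r mulVf// lt0r_neq0//; lra.
have al1 : alpha < 1 by have : 0 < alpha * rho1 by [exact: mulr_gt0]; lra.
have alr : 0 < alpha * rho2 by exact: mulr_gt0.
have alr12 : alpha * rho2 < alpha * rho1 by rewrite ltr_pM2l.
set be := 1 - alpha - alpha * rho2 in r_le *.
(* As αρ1 = 1-α, the hypothesis ρ2 < ρ1 is exactly the positivity of this exponent. *)
have be0 : 0 < be by rewrite /be; lra.
have be1 : be < 1 by rewrite /be; lra.
have exE : alpha + alpha * rho2 = 1 - be by rewrite /be; ring.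
rewrite exE in r_le.
set Gm := green_min omega G in r_le growth_lt1 *.
set GM := green_max omega G in growth_lt1 *.
have Gm0 : 0 < Gm by exact: (green_min_gt0 omega_gt0 G_green).
have wI : 0 <= (0 : K) <= omega by rewrite lexx ltW.
have GmM : Gm <= GM.
  by have /andP[h1 h2] := green_range omega_gt0 G_green wI wI; exact: le_trans h1 h2.
have GM0 : 0 < GM by exact: lt_le_trans GmM.
have [D0 _] := green_dmax_spec omega_gt0 G_green.
set D := green_dmax omega G in D0.
have de0 : 0 <= delta by rewrite deltaE divr_ge0// ltW.
have deG : D = delta * Gm by rewrite deltaE /green_delta -/D -/Gm divfK// lt0r_neq0.
have sE : sigma = Gm / (GM + D) by [].
have s0 : 0 < sigma by rewrite sE divr_gt0//; lra.
have s1 : sigma <= 1 by rewrite sE ler_pdivrMr; lra.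
have [cmin [tc cmE]] := per_extrema omega_gt0 c_cont c_per.
have [emin [te emE]] := per_extrema omega_gt0 e_cont e_per.
have [bmin _] := per_extrema omega_gt0 b_cont b_per.
set cm := per_min omega c in cmin cmE r_le.
set em := per_min omega e in emin emE r_ge.
set bm := per_min omega b in bmin r_ge.
have cm0 : 0 < cm by rewrite cmE.
have em0 : 0 < em by rewrite emE.
pose mu := 1 - alpha.
have mu0 : 0 < mu by rewrite /mu; lra.
have mu1 : mu < 1 by rewrite /mu; lra.
pose m := sigma * r.
have m0 : 0 < m by exact: mulr_gt0.
have mr : m <= r by rewrite /m ler_piMl// ltW.
have ebm : - (bm / em) <= m `^ mu.
  set z := Num.max 0 _ in r_ge.
  have z0 : 0 <= z by rewrite le_max lexx.
  have : z `^ (1 / mu) <= m.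
    by rewrite /m -ler_pdivrMl// -[sigma^-1]mul1r.
  move=> /(ge0_ler_powR (ltW mu0) (powR_ge0 _ _) (ltW m0)).
  rewrite -powRrM mul1r mulVf ?lt0r_neq0// powRr1//.
  by apply: le_trans; rewrite le_max lexx orbT.
have ebp t : 0 <= e t / alpha * m `^ mu + b t / alpha.
  have h1 : 0 <= em * m `^ mu + bm.
    have : - (bm / em) * em <= m `^ mu * em by rewrite ler_pM2r.
    by rewrite mulNr divfK ?lt0r_neq0//; lra.
  have h2 : em * m `^ mu <= e t * m `^ mu by rewrite ler_wpM2r// powR_ge0.
  rewrite mulrAC -mulrDl divr_ge0// ?(ltW al0)//.
  by have := bmin t; lra.
(* [A] is the lower bound that the solution will satisfy. Raising [r_le] to the power 1-be and
   multiplying by r^be turns it into r ≤ A. *)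
pose A := Gm * (cm / alpha * m `^ be * omega).
have rA : r <= A.
  set X := _ * _ * _ * _ / _ in r_le.
  have X0 : 0 <= X by rewrite /X divr_ge0 ?(ltW al0)// !mulr_ge0 ?powR_ge0 ?ltW.
  have : r `^ (1 - be) <= X.
    have be1' : 0 < 1 - be by lra.
    move/(ge0_ler_powR (ltW be1') (ltW r_gt0) (powR_ge0 _ _)): r_le.
    by rewrite -powRrM mul1r mulVf ?lt0r_neq0// powRr1.
  have rE : r = r `^ (1 - be) * r `^ be.
    by rewrite -powRD ?subrK ?powRr1 ?ltW// oner_eq0.
  have -> : A = X * r `^ be.
    by rewrite /A /X /m powRM ?ltW//; ring.
  by move=> h; rewrite [X in X <= _]rE ler_wpM2r// powR_ge0.
pose ca t := c t / alpha; pose ea t := e t / alpha; pose ba t := b t / alpha.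
pose qa t := q t / alpha.
have divc (f : K -> K) : continuous f -> continuous (fun t => f t / alpha).
  by move=> fc t; apply: cvgM; [exact: fc|exact: cvg_cst].
have divp (f : K -> K) : periodic f omega -> periodic (fun t => f t / alpha) omega.
  by move=> fp t; rewrite fp.
have [Bc [Bc0 HBc]] := periodic_bounded omega_gt0 (divc _ c_cont) (divp _ c_per).
have [Be [Be0 HBe]] := periodic_bounded omega_gt0 (divc _ e_cont) (divp _ e_per).
have [Bb [Bb0 HBb]] := periodic_bounded omega_gt0 (divc _ b_cont) (divp _ b_per).
have GMw : 0 < GM * omega by exact: mulr_gt0.
have kap : GM * omega * mu * delta ^+ 2 < 1.
  move: growth_lt1; rewrite ltr_pdivrMr// mul1r -/mu -deG => h.
  have h2 : 0 <= mu * D * delta ^+ 2 * omega.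
    by rewrite !mulr_ge0 ?sqr_ge0 ?(ltW mu0) ?(ltW omega_gt0).
  by lra.
have [R0 [mR0 HR0]] := @sublinear_level K m (GM * omega * mu * delta ^+ 2)
  (GM * omega * Bc) (GM * omega * Be) (GM * omega * Bb) be mu
  (introT andP (conj be0 be1)) (introT andP (conj mu0 mu1))
  (mulr_ge0 (ltW GMw) Bc0) (mulr_ge0 (ltW GMw) Be0) kap.
have high : GM * ((Bc * R0 `^ be + Be * R0 `^ mu + mu * (delta ^+ 2 * R0) + Bb) * omega) <= R0.
  by apply: le_trans HR0; rewrite le_eqVlt; apply/orP; left; apply/eqP; ring.
have dG : D <= delta * Gm by rewrite deG.
have cmin' t : cm / alpha <= ca t by rewrite ler_pM2r// invr_gt0.
have e0 t : 0 <= ea t by rewrite divr_ge0// ltW.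
have [y [v [g [yw yd vd yE yb]]]] := @bounded_solution_exists K omega p qa ca ea ba G
  be mu mu m R0 delta (cm / alpha) Bc Be Bb omega_gt0 p_cont p_per (divc _ q_cont)
  (divp _ q_per) (divc _ c_cont) (divp _ c_per) (divc _ e_cont) (divp _ e_per)
  (divc _ b_cont) (divp _ b_per) G_green G_gt0
  (introT andP (conj (ltW be0) (ltW be1))) (introT andP (conj (ltW mu0) (ltW mu1)))
  (ltW mu0) m0 mR0 de0 dG (divr_gt0 cm0 al0)
  cmin' HBc HBe HBb
  e0 ebp
  (le_trans mr rA) high.
have y_ge t : r <= y t by have [/andP[h _] _] := yb t; exact: le_trans rA h.
have y_le t : y t <= R0 by have [/andP[]] := yb t.
have y0 t : 0 < y t by exact: lt_le_trans (y_ge t).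
have vE : derive1 y = v.
  by apply/funext => t; rewrite derive1E; have [_ ->] := yd t.
have v_le t : `|v t| <= delta * R0.
  by have [_ h] := yb t; apply: (le_trans h); rewrite ler_wpM2l.
have yc : continuous y by move=> t; exact: is_derive_cont (yd t).
have vc : continuous v by move=> t; exact: is_derive_cont (vd t).
have nc (f : K -> K) : continuous f -> {within `[0, omega], continuous (fun t => `|f t|)}.
  by move=> fc; apply: continuous_subspaceT => t; apply: cvg_norm; exact: fc.
have I0 : `[0, omega] !=set0 by exists 0; rewrite /= in_itv/= lexx ltW.
have sup_bounds (f : K -> K) B : continuous f -> (forall t, `|f t| <= B) ->
    `|f 0| <= sup_norm omega f <= B.
  move=> fc fB; apply/andP; split.
    have [_ h _] := compact_image_bounds I0 (@segment_compact _ 0 omega) (nc _ fc).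
    by apply: h; rewrite /= in_itv/= lexx ltW.
  apply: ge_sup; first by exists `|f 0|, 0 => //; rewrite /= in_itv/= lexx ltW.
  by move=> _ [t _ <-].
have yn t : `|y t| <= R0 by rewrite gtr0_norm.
have /andP[ny1 ny2] := sup_bounds y R0 yc yn.
have /andP[nv1 nv2] := sup_bounds v _ vc v_le.
(* The second entry bounds the C1 norm, since y ≤ R0 and |y'| ≤ δR0; the first only ensures r <
   R. *)
exists (Num.max (r + 1) (R0 + delta * R0)); split.
  by rewrite lt_max; apply/orP; left; lra.
exists y; split=> //.
- apply: (periodic_solution_of_derive yw yd vd) => t.
  by rewrite vE; exact: yE.
- rewrite /C1_norm vE; apply/andP; split.
    have := normr_ge0 (v 0); have := y_ge 0; move: ny1; rewrite gtr0_norm//; lra.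
  by rewrite le_max; apply/orP; right; lra.
- move=> x; split; first by move=> t; exact: powR_gt0.
  exact: (powR_solution al0 alE y0 yw yd vd yE).
Qed.
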